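(* Let $L=L_{\bar 0}\oplus L_{\bar 1}$ be a nilpotent Lie superalgebra of dimension $(k\mid l)$ with $\dim L^2=(0\mid 1)$. Then $\mathcal{M}^{(2)}(L)$ is isomorphic to $$A\Big(\tfrac13 k(k+1)(k-1)+k(l-1)^2+1\ \Big|\ \tfrac13 l(l-1)(l+1)+(l-1)(k^2-l)+1\Big)$$ or to $$A\Big(\tfrac13 k(k+1)(k-1)+k(l-1)^2\ \Big|\ \tfrac13 l(l-1)(l+1)+(l-1)(k^2-l)\Big).$$
   Context: Lie superalgebras are over a fixed algebraically closed ground field. For $L=L_{\bar 0}\oplus L_{\bar 1}$, writing $\dim L=(k\mid l)$ means $\dim L_{\bar 0}=k$ and $\dim L_{\bar 1}=l$. $A(a\mid b)$ denotes the abelian Lie superalgebra of dimension $(a\mid b)$. $L^2=[L,L]$ is the derived subalgebra. A free presentation of $L$ is a short exact sequence $0\to R\to F\to L\to 0$ of Lie superalgebras with $F$ a free Lie superalgebra (on a $\mathbb{Z}_2$-graded set) and $R$ a graded ideal of $F$. The $2$-nilpotent multiplier is $\mathcal{M}^{(2)}(L)=\dfrac{R\cap F^3}{[[R,F],F]}$, where $F^3=[[F,F],F]$ is the third term of the lower central series of $F$; it is an abelian Lie superalgebra and, up to isomorphism, independent of the chosen free presentation.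
   Formalization: The ground field is assumed to have characteristic different from 2; for a Lie superalgebra given by its bracket alone the claim fails in characteristic 2, e.g. for L = <x | y, z> with [x,y] = z. In characteristic 3 the usual axiom [x,[x,x]] = 0 for odd x is part of the definition. *)

(* Defs.v *)
From HB Require Import structures.
From mathcomp Require Import all_boot all_algebra ring_quotient.
From mathcomp Require Import boolp classical_sets.

Set Implicit Arguments.
Unset Strict Implicit.
Unset Printing Implicit Defensive.

Import GRing.Theory.
Local Open Scope ring_scope.
Local Open Scope classical_set_scope.
Local Open Scope quotient_scope.

Definition submodule (K : fieldType) (V : lmodType K) (S : set V) : Prop :=
  S 0 /\ forall a u v, S u -> S v -> S (a *: u + v).

(* A basis indexed by 'I_n, phrased through unique coordinates; unlike \dim it
   makes sense in a module that is not known to be finite-dimensional. *)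
Definition has_dim (K : fieldType) (V : lmodType K) (S : set V) (n : nat) :
    Prop :=
  exists e : 'I_n -> V, (forall i, S (e i)) /\
    forall x, S x -> exists! c : 'rV[K]_n, x = \sum_i c 0 i *: e i.

(* hcomp false and hcomp true are the even and the odd part.  The axiom
   sbracket_cube follows from the Jacobi identity when 3 is invertible, and is
   part of the usual definition in characteristic 3.  The definition is the
   accepted one only when 2 is invertible. *)
HB.mixin Record Lmodule_isLieSuperalgebra (K : fieldType) L
    of GRing.Lmodule K L := {
  hcomp : bool -> set L;
  sbracket : L -> L -> L;
  hcomp_submod : forall i, submodule (hcomp i);
  hcomp_decomp : forall x,
    exists x0 x1, [/\ hcomp false x0, hcomp true x1 & x = x0 + x1];
  hcomp_direct : forall x, hcomp false x -> hcomp true x -> x = 0;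
  sbracketDl : forall a x y z,
    sbracket (a *: x + y) z = a *: sbracket x z + sbracket y z;
  sbracketDr : forall a x y z,
    sbracket z (a *: x + y) = a *: sbracket z x + sbracket z y;
  sbracket_graded : forall i j x y, hcomp i x -> hcomp j y ->
    hcomp (i (+) j) (sbracket x y);
  sbracket_skew : forall i j x y, hcomp i x -> hcomp j y ->
    sbracket x y = - ((-1) ^+ (i && j) *: sbracket y x);
  sbracket_jacobi : forall i j x y z, hcomp i x -> hcomp j y ->
    sbracket x (sbracket y z) =
      sbracket (sbracket x y) z + (-1) ^+ (i && j) *: sbracket y (sbracket x z);
  sbracket_cube : forall x, hcomp true x -> sbracket x (sbracket x x) = 0
}.

#[short(type="lieSuperType")]
HB.structure Definition LieSuperalgebra (K : fieldType) :=
  {L of GRing.Lmodule K L & Lmodule_isLieSuperalgebra K L}.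

Arguments sbracket_graded {K s i j x y}.
Arguments sbracket_skew {K s i j x y}.
Arguments sbracket_jacobi {K s i j x y} z.

Notation "[s x , y ]" := (sbracket x y)
  (at level 0, x, y at level 99, format "[s  x ,  y ]") : ring_scope.

Definition lie_shom (K : fieldType) (L M : lieSuperType K) (f : L -> M) :
    Prop :=
  [/\ forall a x y, f (a *: x + y) = a *: f x + f y,
      forall i x, hcomp i x -> hcomp i (f x) &
      forall x y, f [s x, y] = [s f x, f y]].

Definition lie_siso (K : fieldType) (L M : lieSuperType K) : Prop :=
  exists f : L -> M, lie_shom f /\ bijective f.

Definition graded (K : fieldType) (L : lieSuperType K) (S : set L) : Prop :=
  forall x, S x -> exists x0 x1,
    [/\ (S `&` hcomp false) x0, (S `&` hcomp true) x1 & x = x0 + x1].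

(* For a graded subspace, [s x, y] \in I and [s y, x] \in I are equivalent
   requirements by graded skew-symmetry. *)
Definition graded_ideal (K : fieldType) (L : lieSuperType K) (I : set L) :
    Prop :=
  [/\ submodule I, graded I & forall x y, I x -> I [s x, y]].

Record gideal (K : fieldType) (L : lieSuperType K) := GIdeal {
  gideal_set :> set L;
  gidealP : graded_ideal gideal_set
}.

Definition scomm (K : fieldType) (L : lieSuperType K) (I J : set L) : set L :=
  smallest (@submodule K L) [set [s x, y] | x in I & y in J].

Section BracketTheory.
Context (K : fieldType) (L : lieSuperType K).
Implicit Types (x y z : L) (I J : set L).

Section Submodule.
Context (V : lmodType K) (S : set V) (subS : submodule S).

Lemma submod0 : S 0. Proof. by case: subS. Qed.

Lemma submodP a u v : S u -> S v -> S (a *: u + v).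
Proof. by case: subS => _; apply. Qed.

Lemma submodZ a u : S u -> S (a *: u).
Proof. by move=> Su; rewrite -[_ *: _]addr0; apply: submodP submod0. Qed.

Lemma submodD u v : S u -> S v -> S (u + v).
Proof. by move=> Su Sv; rewrite -[u]scale1r; apply: submodP. Qed.

Lemma submodN u : S u -> S (- u).
Proof. by rewrite -scaleN1r; apply: submodZ. Qed.

Lemma submodB u v : S u -> S v -> S (u - v).
Proof. by move=> Su Sv; apply: submodD => //; apply: submodN. Qed.
End Submodule.

Lemma sbracket0l z : [s 0, z] = 0.
Proof.
by have := sbracketDl (-1) (0 : L) 0 z; rewrite scaler0 addr0 scaleN1r addNr.
Qed.

Lemma sbracket0r z : [s z, 0] = 0.
Proof.
by have := sbracketDr (-1) (0 : L) 0 z; rewrite scaler0 addr0 scaleN1r addNr.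
Qed.

Lemma sbracketAl x y z : [s x + y, z] = [s x, z] + [s y, z].
Proof. by rewrite -[x in LHS]scale1r sbracketDl scale1r. Qed.

Lemma sbracketAr x y z : [s z, x + y] = [s z, x] + [s z, y].
Proof. by rewrite -[x in LHS]scale1r sbracketDr scale1r. Qed.

Lemma sbracketBl x y z : [s x - y, z] = [s x, z] - [s y, z].
Proof. by rewrite -[in LHS]scaleN1r addrC sbracketDl scaleN1r addrC. Qed.

Lemma sbracketBr x y z : [s z, x - y] = [s z, x] - [s z, y].
Proof. by rewrite -[in LHS]scaleN1r addrC sbracketDr scaleN1r addrC. Qed.

Lemma gidealS I : graded_ideal I -> submodule I. Proof. by case. Qed.

Lemma gideal_graded I : graded_ideal I -> graded I. Proof. by case. Qed.

Lemma gidealMr I x y : graded_ideal I -> I x -> I [s x, y].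
Proof. by case=> _ _; apply. Qed.

Lemma gidealMl I x y : graded_ideal I -> I x -> I [s y, x].
Proof.
move=> gI /(gideal_graded gI) [x0 [x1 [[Ix0 x00] [Ix1 x11] ->]]].
have [y0 [y1 [y00 y11 ->]]] := hcomp_decomp y.
have hom i j u v : I u -> hcomp i u -> hcomp j v -> I [s v, u].
  move=> Iu ui vj; rewrite (sbracket_skew vj ui).
  have SI := gidealS gI; apply: (submodN SI); apply: (submodZ SI).
  exact: gidealMr.
rewrite sbracketAl !sbracketAr.
apply: (submodD (gidealS gI)); apply: (submodD (gidealS gI)).
- exact: hom Ix0 x00 y00.
- exact: hom Ix1 x11 y00.
- exact: hom Ix0 x00 y11.
- exact: hom Ix1 x11 y11.
Qed.

Lemma setT_graded_ideal : graded_ideal [set: L].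
Proof.
split=> // x _; have [x0 [x1 [x00 x11 ->]]] := hcomp_decomp x.
by exists x0, x1.
Qed.

Lemma submodule_scomm (I J : set L) : submodule (scomm I J).
Proof.
split=> [A [[A0 _] _] // | a u v Su Sv A AS].
by case: (AS) => -[_ Alin] _; apply: Alin; [apply: Su | apply: Sv].
Qed.

Lemma mem_scomm (I J : set L) x y : I x -> J y -> scomm I J [s x, y].
Proof. by move=> Ix Jy; apply: sub_gen_smallest; exists x => //; exists y. Qed.

Lemma graded_submodule (S : set L) :
  submodule S -> submodule [set x | exists x0 x1,
    [/\ (S `&` hcomp false) x0, (S `&` hcomp true) x1 & x = x0 + x1]].
Proof.
move=> subS; split=> [|a u v].
  have h0 i : (S `&` hcomp i) 0.
    by split; apply: submod0 => //; apply: hcomp_submod.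
  by exists 0, 0; rewrite addr0; split.
move=> [u0 [u1 [[Su0 u00] [Su1 u11] ->]]] [v0 [v1 [[Sv0 v00] [Sv1 v11] ->]]].
exists (a *: u0 + v0), (a *: u1 + v1); split.
- by split; [apply: submodP|apply: submodP => //; apply: hcomp_submod].
- by split; [apply: submodP|apply: submodP => //; apply: hcomp_submod].
- by rewrite scalerDr addrACA.
Qed.

Lemma scomm_graded_ideal I J :
  graded_ideal I -> graded_ideal J -> graded_ideal (scomm I J).
Proof.
move=> gI gJ.
have subC := submodule_scomm I J; split=> //.
  move=> x; apply: (smallest_sub (graded_submodule subC)) => {x}.
  move=> _ [x Ix [y Jy <-]].
  have [x0 [x1 [[Ix0 x00] [Ix1 x11] ->]]] := gideal_graded gI Ix.
  have [y0 [y1 [[Jy0 y00] [Jy1 y11] ->]]] := gideal_graded gJ Jy.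
  exists ([s x0, y0] + [s x1, y1]), ([s x0, y1] + [s x1, y0]); split.
  - split; first by apply: (submodD subC); apply: mem_scomm.
    apply: (submodD (hcomp_submod false)).
      exact: (sbracket_graded x00 y00).
    exact: (sbracket_graded x11 y11).
  - split; first by apply: (submodD subC); apply: mem_scomm.
    apply: (submodD (hcomp_submod true)).
      exact: (sbracket_graded x00 y11).
    exact: (sbracket_graded x11 y00).
  - by rewrite sbracketAl !sbracketAr [RHS]addrACA [[s x1, y1] + _]addrC.
move=> w z; move: w.
have subD : submodule [set w | scomm I J [s w, z]].
  split=> [|a u v Su Sv] /=; first by rewrite sbracket0l; apply: (submod0 subC).
  by rewrite sbracketDl; apply: (submodP subC).
move=> w; apply: (smallest_sub subD) => {w} _ [x Ix [y Jy <-]] /=.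
have [x0 [x1 [[Ix0 x00] [Ix1 x11] ->]]] := gideal_graded gI Ix.
have [y0 [y1 [[Jy0 y00] [Jy1 y11] ->]]] := gideal_graded gJ Jy.
have [z0 [z1 [z00 z11 ->]]] := hcomp_decomp z.
have hom i j k u v t : I u -> J v -> hcomp i u -> hcomp j v -> hcomp k t ->
    scomm I J [s [s u, v], t].
  move=> Iu Jv ui vj tk.
  have /eqP := sbracket_jacobi t ui vj; rewrite -subr_eq => /eqP <-.
  apply: (submodB subC).
    by apply: mem_scomm => //; apply: gidealMr.
  apply: (submodZ subC); rewrite (sbracket_skew vj (sbracket_graded ui tk)).
  apply: (submodN subC); apply: (submodZ subC); apply: mem_scomm => //.
  exact: gidealMr.
rewrite !(sbracketAl, sbracketAr).
by apply: (submodD subC); apply: (submodD subC); apply: (submodD subC);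
  apply: hom; eassumption.
Qed.

Lemma setI_graded_ideal I J :
  graded_ideal I -> graded_ideal J -> graded_ideal (I `&` J).
Proof.
move=> gI gJ.
split.
- split=> [|a u v [Iu Ju] [Iv Jv]].
    by split; apply: submod0; apply: gidealS.
  by split; apply: submodP => //; apply: gidealS.
- move=> x [Ix Jx].
  have [x0 [x1 [[Ix0 x00] [Ix1 x11] xE]]] := gideal_graded gI Ix.
  have [y0 [y1 [[Jy0 y00] [Jy1 y11] yE]]] := gideal_graded gJ Jx.
  have e : x0 - y0 = y1 - x1.
    by apply/eqP; rewrite subr_eq addrAC eq_sym subr_eq addrC -yE xE addrC.
  have /eqP : x0 - y0 = 0.
    apply: hcomp_direct; first by apply: submodB => //; apply: hcomp_submod.
    by rewrite e; apply: submodB => //; apply: hcomp_submod.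
  rewrite subr_eq0 => /eqP e0.
  have /eqP : y1 - x1 = 0 by rewrite -e e0 subrr.
  rewrite subr_eq0 => /eqP e1.
  by exists x0, x1; split=> //; do 2?split=> //; rewrite ?e0 -?e1.
- by move=> x y [Ix Jx]; split; apply: gidealMr.
Qed.

End BracketTheory.

Lemma ker_graded_ideal (K : fieldType) (L M : lieSuperType K) (f : L -> M) :
  lie_shom f -> graded_ideal [set x | f x = 0].
Proof.
case=> flin fhom fbr.
have f0 : f 0 = 0.
  by have := flin (-1) 0 0; rewrite scaler0 addr0 scaleN1r addNr.
have fD x y : f (x + y) = f x + f y by rewrite -[x]scale1r flin !scale1r.
split=> [|x|x y /= fx0].
- by split=> // a u v /= fu fv; rewrite flin fu fv scaler0 addr0.
- have [x0 [x1 [x00 x11 ->]]] := hcomp_decomp x => /= /eqP.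
  rewrite fD addr_eq0 => /eqP fx0.
  have fx00 : f x0 = 0.
    apply: hcomp_direct; first exact: fhom.
    by rewrite fx0; apply: submodN; [apply: hcomp_submod|apply: fhom].
  exists x0, x1; split=> //; split=> //=.
  by apply/eqP; rewrite -oppr_eq0 -fx0 fx00.
- by rewrite fbr fx0 sbracket0l.
Qed.

Definition gfull (K : fieldType) (L : lieSuperType K) : gideal L :=
  GIdeal (setT_graded_ideal L).

Definition gcomm (K : fieldType) (L : lieSuperType K) (I J : gideal L) :
  gideal L := 
  GIdeal (scomm_graded_ideal (gidealP I) (gidealP J)).

Definition gcap (K : fieldType) (L : lieSuperType K) (I J : gideal L) :
  gideal L := 
  GIdeal (setI_graded_ideal (gidealP I) (gidealP J)).

Definition gker (K : fieldType) (L M : lieSuperType K) (f : L -> M)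
  (fhom : lie_shom f) : gideal L := GIdeal (ker_graded_ideal fhom).

(* Indexed so that lcs L 1 = L, lcs L 2 = [L, L], lcs L 3 = [[L, L], L]. *)
Definition lcs (K : fieldType) (L : lieSuperType K) (n : nat) : gideal L :=
  iter n.-1 (fun I => gcomm I (gfull L)) (gfull L).

Definition lie_nilpotent (K : fieldType) (L : lieSuperType K) : Prop :=
  exists n, (lcs L n : set L) = [set 0].

Definition has_sdim (K : fieldType) (L : lieSuperType K) (I : gideal L)
    (k l : nat) : Prop :=
  has_dim (I `&` hcomp false) k /\ has_dim (I `&` hcomp true) l.

(* The quotient of the graded ideal I, seen as a Lie superalgebra, by its
   ideal I `&` J. *)
Section SubQuotient.
Context (K : fieldType) (L : lieSuperType K) (I J : gideal L).

Definition gsub_pred (x : L) : bool := `[< (I : set L) x >].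

Lemma gsub_submod : submod_closed gsub_pred.
Proof.
split=> [|a u v /asboolP Iu /asboolP Iv]; apply/asboolP.
  exact: (submod0 (gidealS (gidealP _))).
exact: (submodP (gidealS (gidealP I))).
Qed.

HB.instance Definition _ :=
  GRing.isSubmodClosed.Build K L gsub_pred gsub_submod.

Definition gsub : Type := {x : L | gsub_pred x}.
HB.instance Definition _ := SubChoice.on gsub.
HB.instance Definition _ := [SubChoice_isSubLmodule of gsub by <:].

Definition gval (x : gsub) : L := val x.

Lemma gval_inj : injective gval. Proof. exact: val_inj. Qed.

Lemma gval0 : gval 0 = 0. Proof. exact: raddf0. Qed.

Lemma gvalD x y : gval (x + y) = gval x + gval y. Proof. exact: raddfD. Qed.

Lemma gvalB x y : gval (x - y) = gval x - gval y. Proof. exact: raddfB. Qed.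

Lemma gvalZ a x : gval (a *: x) = a *: gval x. Proof. exact: linearZ. Qed.

Lemma gsubP (x : gsub) : (I : set L) (gval x). Proof. exact/asboolP/(valP x). Qed.

Definition gquo_pred (x : gsub) : bool := `[< (J : set L) (gval x) >].

Lemma gquo_zmod : zmod_closed gquo_pred.
Proof.
split=> [|u v /asboolP Ju /asboolP Jv]; apply/asboolP.
  by rewrite gval0; exact: (submod0 (gidealS (gidealP _))).
by rewrite gvalB; apply: (submodB (gidealS (gidealP J))).
Qed.

HB.instance Definition _ := GRing.isZmodClosed.Build gsub gquo_pred gquo_zmod.

Definition squo : Type :=
  Quotient.quot (GRing.ZmodClosed.clone gsub gquo_pred _).
HB.instance Definition _ := GRing.Zmodule.on squo.

Definition sproj (x : gsub) : squo := \pi_squo x.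

Lemma sproj_eq (x y : gsub) : sproj x = sproj y <-> (J : set L) (gval x - gval y).
Proof.
rewrite -gvalB; split=> [/eqP|Jxy]; last apply/eqP.
  by rewrite -Quotient.idealrBE => /asboolP.
by rewrite -Quotient.idealrBE; apply/asboolP.
Qed.

Lemma sproj_surj (q : squo) : exists x, sproj x = q.
Proof. by exists (repr q); apply: reprK. Qed.

Lemma sproj_repr (x : gsub) : (J : set L) (gval (repr (sproj x)) - gval x).
Proof. by apply/sproj_eq; apply: reprK. Qed.

Lemma sprojD x y : sproj (x + y) = sproj x + sproj y.
Proof. by rewrite /sproj !piE. Qed.

Lemma sproj0 : sproj 0 = 0.
Proof. by apply: (addrI (sproj 0)); rewrite -sprojD !addr0. Qed.

Definition sscale (a : K) (q : squo) : squo := sproj (a *: repr q).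

Lemma sscaleE a x : sscale a (sproj x) = sproj (a *: x).
Proof.
apply/sproj_eq; rewrite !gvalZ -scalerBr.
by apply: (submodZ (gidealS (gidealP J))); apply: sproj_repr.
Qed.

Lemma sscaleA a b q : sscale a (sscale b q) = sscale (a * b) q.
Proof. by have [x <-] := sproj_surj q; rewrite !sscaleE scalerA. Qed.

Lemma sscale1 : left_id 1 sscale.
Proof. by move=> q; have [x <-] := sproj_surj q; rewrite sscaleE scale1r. Qed.

Lemma sscaleDr : right_distributive sscale +%R.
Proof.
move=> a p q; have [x <-] := sproj_surj p; have [y <-] := sproj_surj q.
by rewrite -sprojD !sscaleE scalerDr sprojD.
Qed.

Lemma sscaleDl q : {morph sscale^~ q : a b / a + b}.
Proof.
by move=> a b; have [x <-] := sproj_surj q; rewrite !sscaleE scalerDl sprojD.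
Qed.

HB.instance Definition _ :=
  GRing.Zmodule_isLmodule.Build K squo sscaleA sscale1 sscaleDr sscaleDl.

Lemma sprojZ a x : sproj (a *: x) = a *: sproj x.
Proof. by rewrite -sscaleE. Qed.

Definition gbracket (x y : gsub) : gsub :=
  exist _ [s gval x, gval y] (asboolT (gidealMr (gval y) (gidealP I) (gsubP x))).

Lemma gvalM x y : gval (gbracket x y) = [s gval x, gval y]. Proof. by []. Qed.

Definition squo_bracket (p q : squo) : squo :=
  sproj (gbracket (repr p) (repr q)).

Definition squo_hcomp (i : bool) : set squo :=
  [set sproj x | x in [set x : gsub | hcomp i (gval x)]].

Lemma squo_bracketE x y :
  squo_bracket (sproj x) (sproj y) = sproj (gbracket x y).
Proof.
apply/sproj_eq => /=; set x' := repr _; set y' := repr _.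
rewrite -(subrKA [s gval x, gval y']) -sbracketBl -sbracketBr.
apply: (submodD (gidealS (gidealP J))).
  by apply: (gidealMr _ (gidealP J)); apply: sproj_repr.
by apply: (gidealMl _ (gidealP J)); apply: sproj_repr.
Qed.

Lemma squo_hcomp_submod i : submodule (squo_hcomp i).
Proof.
split=> [|a _ _ [x xi <-] [y yi <-]].
  by exists 0; [rewrite /= gval0; exact: (submod0 (hcomp_submod i))|exact: sproj0].
exists (a *: x + y); last by rewrite sprojD sprojZ.
by rewrite /= gvalD gvalZ; apply: submodP => //; apply: hcomp_submod.
Qed.

Lemma gsub_decomp (x : gsub) : exists x0 x1 : gsub,
  [/\ hcomp false (gval x0), hcomp true (gval x1) & x = x0 + x1].
Proof.
have [x0 [x1 [[Ix0 x00] [Ix1 x11] xE]]] := gideal_graded (gidealP I) (gsubP x).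
exists (exist _ x0 (asboolT Ix0)), (exist _ x1 (asboolT Ix1)); split=> //.
exact: gval_inj.
Qed.

Lemma squo_hcomp_decomp q : exists q0 q1,
  [/\ squo_hcomp false q0, squo_hcomp true q1 & q = q0 + q1].
Proof.
have [x <-] := sproj_surj q; have [x0 [x1 [x00 x11 ->]]] := gsub_decomp x.
by exists (sproj x0), (sproj x1); split; [exists x0|exists x1|apply: sprojD].
Qed.

Lemma squo_hcomp_direct q : squo_hcomp false q -> squo_hcomp true q -> q = 0.
Proof.
case=> x x0 <- [y y1 /esym/sproj_eq Jxy].
have [u [v [[Ju u0] [Jv v1] uvE]]] := gideal_graded (gidealP J) Jxy.
rewrite -sproj0; apply/sproj_eq; rewrite gval0 subr0.
suff -> : gval x = u by [].
have e : gval x - u = gval y + v.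
  apply/eqP; rewrite subr_eq -addrA [v + u]addrC -uvE addrC.
  by rewrite -addrA addNr addr0.
apply/eqP; rewrite -subr_eq0; apply/eqP/hcomp_direct.
  by apply: submodB => //; apply: hcomp_submod.
by rewrite e; apply: submodD => //; apply: hcomp_submod.
Qed.

Lemma squo_bracketDl a p q r : squo_bracket (a *: p + q) r =
  a *: squo_bracket p r + squo_bracket q r.
Proof.
have [x <-] := sproj_surj p; have [y <-] := sproj_surj q.
have [z <-] := sproj_surj r.
rewrite -sprojZ -sprojD !squo_bracketE -sprojZ -sprojD; congr sproj.
by apply: gval_inj; rewrite !(gvalM, gvalD, gvalZ) sbracketDl.
Qed.

Lemma squo_bracketDr a p q r : squo_bracket r (a *: p + q) =
  a *: squo_bracket r p + squo_bracket r q.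
Proof.
have [x <-] := sproj_surj p; have [y <-] := sproj_surj q.
have [z <-] := sproj_surj r.
rewrite -sprojZ -sprojD !squo_bracketE -sprojZ -sprojD; congr sproj.
by apply: gval_inj; rewrite !(gvalM, gvalD, gvalZ) sbracketDr.
Qed.

Lemma squo_bracket_graded i j p q : squo_hcomp i p -> squo_hcomp j q ->
  squo_hcomp (i (+) j) (squo_bracket p q).
Proof.
case=> x xi <- [y yj <-]; rewrite squo_bracketE.
by exists (gbracket x y) => //; apply: sbracket_graded.
Qed.

Lemma squo_bracket_skew i j p q : squo_hcomp i p -> squo_hcomp j q ->
  squo_bracket p q = - ((-1) ^+ (i && j) *: squo_bracket q p).
Proof.
case=> x xi <- [y yj <-]; rewrite !squo_bracketE -scaleNr -sprojZ.
by congr sproj; apply: gval_inj; rewrite gvalZ !gvalM scaleNr -sbracket_skew.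
Qed.

Lemma squo_bracket_jacobi i j p q r : squo_hcomp i p -> squo_hcomp j q ->
  squo_bracket p (squo_bracket q r) = squo_bracket (squo_bracket p q) r +
    (-1) ^+ (i && j) *: squo_bracket q (squo_bracket p r).
Proof.
case=> x xi <- [y yj <-]; have [z <-] := sproj_surj r.
rewrite !squo_bracketE -sprojZ -sprojD; congr sproj; apply: gval_inj.
by rewrite !(gvalM, gvalD, gvalZ) (sbracket_jacobi _ xi yj).
Qed.

Lemma squo_bracket_cube p :
  squo_hcomp true p -> squo_bracket p (squo_bracket p p) = 0.
Proof.
case=> x x1 <-; rewrite !squo_bracketE -sproj0; congr sproj.
by apply: gval_inj; rewrite gval0 !gvalM; apply: sbracket_cube.
Qed.

HB.instance Definition _ := Lmodule_isLieSuperalgebra.Build K squo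
  squo_hcomp_submod squo_hcomp_decomp squo_hcomp_direct squo_bracketDl
  squo_bracketDr squo_bracket_graded squo_bracket_skew squo_bracket_jacobi
  squo_bracket_cube.

End SubQuotient.

(* A(a | b), with even part the first factor and odd part the second. *)
Section Abelian.
Context (K : fieldType) (a b : nat).

Definition abelian_super : Type := ('rV[K]_a * 'rV[K]_b)%type.
HB.instance Definition _ := GRing.Lmodule.on abelian_super.

Definition abelian_hcomp (i : bool) : set abelian_super :=
  [set x | if i then x.1 = 0 else x.2 = 0].

Definition abelian_bracket (x y : abelian_super) : abelian_super := 0.

Lemma abelian_hcomp_submod i : submodule (abelian_hcomp i).
Proof.
by case: i; split=> // c u v /= u0 v0; rewrite u0 v0 scaler0 addr0.
Qed.

Lemma abelian_hcomp_decomp x : exists x0 x1,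
  [/\ abelian_hcomp false x0, abelian_hcomp true x1 & x = x0 + x1].
Proof.
case: x => x y; exists (x, 0), (0, y); split=> //.
by congr pair; rewrite /= ?addr0 ?add0r.
Qed.

Lemma abelian_hcomp_direct x :
  abelian_hcomp false x -> abelian_hcomp true x -> x = 0.
Proof. by case: x => x y /= -> ->. Qed.

Lemma abelian_bracketDl c x y z : abelian_bracket (c *: x + y) z =
  c *: abelian_bracket x z + abelian_bracket y z.
Proof. by rewrite /abelian_bracket scaler0 addr0. Qed.

Lemma abelian_bracketDr c x y z : abelian_bracket z (c *: x + y) =
  c *: abelian_bracket z x + abelian_bracket z y.
Proof. by rewrite /abelian_bracket scaler0 addr0. Qed.

Lemma abelian_graded i j x y : abelian_hcomp i x -> abelian_hcomp j y ->
  abelian_hcomp (i (+) j) (abelian_bracket x y).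
Proof. by move=> _ _; case: (i (+) j). Qed.

Lemma abelian_skew i j x y : abelian_hcomp i x -> abelian_hcomp j y ->
  abelian_bracket x y = - ((-1) ^+ (i && j) *: abelian_bracket y x).
Proof. by rewrite /abelian_bracket scaler0 oppr0. Qed.

Lemma abelian_jacobi i j x y z : abelian_hcomp i x -> abelian_hcomp j y ->
  abelian_bracket x (abelian_bracket y z) =
    abelian_bracket (abelian_bracket x y) z +
    (-1) ^+ (i && j) *: abelian_bracket y (abelian_bracket x z).
Proof. by rewrite /abelian_bracket scaler0 addr0. Qed.

Lemma abelian_cube x : abelian_hcomp true x ->
  abelian_bracket x (abelian_bracket x x) = 0.
Proof. by []. Qed.

HB.instance Definition _ := Lmodule_isLieSuperalgebra.Build K abelian_super
  abelian_hcomp_submod abelian_hcomp_decomp abelian_hcomp_direct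
  abelian_bracketDl abelian_bracketDr abelian_graded abelian_skew
  abelian_jacobi abelian_cube.

End Abelian.

Definition free_on (K : fieldType) (F : lieSuperType K) (X : Type)
    (par : X -> bool) (inc : X -> F) : Prop :=
  (forall x, hcomp (par x) (inc x)) /\
  forall (G : lieSuperType K) (g : X -> G), (forall x, hcomp (par x) (g x)) ->
    exists! f : F -> G, lie_shom f /\ forall x, f (inc x) = g x.

Record free_presentation (K : fieldType) (L : lieSuperType K) := {
  fp_alg : lieSuperType K;
  fp_gen : Type;
  fp_par : fp_gen -> bool;
  fp_inc : fp_gen -> fp_alg;
  fp_free : free_on fp_par fp_inc;
  fp_map : fp_alg -> L;
  fp_hom : lie_shom fp_map;
  fp_surj : forall y, exists x, fp_map x = y
}.

Definition fp_ker (K : fieldType) (L : lieSuperType K)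
  (P : free_presentation L) : gideal (fp_alg P) := gker (fp_hom P).

(* (R /\ F^3) / [[R, F], F]; up to isomorphism it does not depend on P. *)
Definition nil2_multiplier (K : fieldType) (L : lieSuperType K)
    (P : free_presentation L) : lieSuperType K :=
  let F := gfull (fp_alg P) in
  squo (gcap (fp_ker P) (lcs (fp_alg P) 3)) (gcomm (gcomm (fp_ker P) F) F).

(* Main.v *)
From HB Require Import structures.
Require Import Defs.
From mathcomp Require Import all_boot all_algebra.
From mathcomp Require Import boolp classical_sets ring zify.
Import GRing.Theory.
Local Open Scope ring_scope.

Set Implicit Arguments.
Unset Strict Implicit.
Unset Printing Implicit Defensive.

(** Write L^2 = K z with z odd.  Nilpotency makes z central, so the bracket of L
is z times a bilinear pairing between the even part and the odd part modulo z,
and a suitable homogeneous basis v_i (k even vectors, then n = l - 1 odd ones)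
puts this pairing in the form pid_mx r with r > 0 (heis_basis_exists): L is a
Heisenberg superalgebra with odd centre plus an abelian summand.

Let 0 -> R -> F -> L -> 0 be any free presentation, J = [[R, F], F], and choose
homogeneous lifts g_i of the v_i.  As L has class two, F^3 is contained in R
and the multiplier is F^3 / J.  A triple bracket changes by an element of J
when an entry moves within its class modulo R, so F^3 is spanned modulo J by
brackets in the g_i and in w = [x, y], where x and y are the lifts of the first
even and the first odd basis vector and w lifts z.  Two families remain:

- the cubic brackets [[g_i, g_j], g_h], which reduce by skew-symmetry and the
  Jacobi identity to the Hall triples j < i, j <= h, exactly as in the degree 3
  part of a free Lie superalgebra (hall_span);
- the quartic brackets [[w, g_i], g_j].  If r > 1, then w may be replaced by
  the bracket of another dual pair that commutes with v_i, and the Jacobi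
  identity gives [w, g_i] in [R, F], so that they all vanish.  If r = 1, the
  same argument leaves only [[w, x], x], odd, and [[w, x], y], even.

For the linear independence, every basis element is detected by the coefficient
of a word in the letters v_i.  Instead of a tensor algebra, one word at a
time is realised by a homomorphism from F to a Lie superalgebra of upper
triangular matrices in which each letter acts by superdiagonal entries at its
positions in the word (word_form3, word_form4).  It kills J because R is sent
to a high enough degree; that is checked on the generators of F and propagated
by the induction principle free_ind.  The words yxxx and xyxy detect the two
quartic classes: neither contains yy, so that [y, y], which lies in R, acts by
zero.  The coefficient of xyxy is 2.

Counting Hall triples by parity gives k (k + 1) (k - 1) / 3 + k n^2 even and
n (n + 1) (n - 1) / 3 + n k^2 odd ones, with one more of each when r = 1. *)

(** * Subalgebras and induction on a free superalgebra *)

Record subalgebra (K : fieldType) (F : lieSuperType K) := Subalgebra {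
  subalg_set :> set F;
  subalg_submod : submodule subalg_set;
  subalg_graded : graded subalg_set;
  subalg_bracket : forall x y, subalg_set x -> subalg_set y ->
    subalg_set [s x, y]
}.

Section SubalgebraType.
Context (K : fieldType) (F : lieSuperType K) (S : subalgebra F).

Definition subalg_pred (x : F) : bool := `[< (S : set F) x >].

Lemma subalg_pred_closed : submod_closed subalg_pred.
Proof.
split=> [|a u v /asboolP Su /asboolP Sv]; apply/asboolP.
  exact: (submod0 (subalg_submod S)).
exact: (submodP (subalg_submod S)).
Qed.

HB.instance Definition _ :=
  GRing.isSubmodClosed.Build K F subalg_pred subalg_pred_closed.

Definition subalg : Type := {x : F | subalg_pred x}.
HB.instance Definition _ := SubChoice.on subalg.
HB.instance Definition _ := [SubChoice_isSubLmodule of subalg by <:].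

Definition subalg_val (x : subalg) : F := val x.

Lemma subalg_val_inj : injective subalg_val. Proof. exact: val_inj. Qed.

Lemma subalg_val0 : subalg_val 0 = 0. Proof. exact: raddf0. Qed.

Lemma subalg_valP a x y : subalg_val (a *: x + y) = a *: subalg_val x + subalg_val y.
Proof. exact: linearP. Qed.

Lemma subalg_valD x y : subalg_val (x + y) = subalg_val x + subalg_val y.
Proof. exact: raddfD. Qed.

Lemma subalg_valN x : subalg_val (- x) = - subalg_val x. Proof. exact: raddfN. Qed.

Lemma subalg_valZ a x : subalg_val (a *: x) = a *: subalg_val x.
Proof. exact: linearZ. Qed.

Lemma subalg_val_mem (x : subalg) : (S : set F) (subalg_val x).
Proof. exact/asboolP/(valP x). Qed.

Definition subalg_mk x (Sx : (S : set F) x) : subalg := exist _ x (asboolT Sx).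

Definition sbr (x y : subalg) : subalg :=
  subalg_mk (subalg_bracket (subalg_val_mem x) (subalg_val_mem y)).

Lemma subalg_valM x y : subalg_val (sbr x y) = [s subalg_val x, subalg_val y].
Proof. by []. Qed.

Definition subalg_hcomp (i : bool) : set subalg := fun x => hcomp i (subalg_val x).

Lemma subalg_hcomp_submod i : submodule (subalg_hcomp i).
Proof.
split=> [|a u v]; rewrite /subalg_hcomp ?subalg_val0 ?subalg_valP.
  exact: (submod0 (hcomp_submod i)).
exact: (submodP (hcomp_submod i)).
Qed.

Lemma subalg_hcomp_decomp x : exists x0 x1,
  [/\ subalg_hcomp false x0, subalg_hcomp true x1 & x = x0 + x1].
Proof.
have [x0 [x1 [[Sx0 x00] [Sx1 x11] xE]]] := subalg_graded (subalg_val_mem x).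
by exists (subalg_mk Sx0), (subalg_mk Sx1); split=> //; apply: subalg_val_inj.
Qed.

Lemma subalg_hcomp_direct x :
  subalg_hcomp false x -> subalg_hcomp true x -> x = 0.
Proof.
by move=> x0 x1; apply: subalg_val_inj; rewrite subalg_val0; apply: hcomp_direct.
Qed.

Lemma sbrDl a x y z : sbr (a *: x + y) z = a *: sbr x z + sbr y z.
Proof. by apply: subalg_val_inj; rewrite !(subalg_valM, subalg_valP) sbracketDl. Qed.

Lemma sbrDr a x y z : sbr z (a *: x + y) = a *: sbr z x + sbr z y.
Proof. by apply: subalg_val_inj; rewrite !(subalg_valM, subalg_valP) sbracketDr. Qed.

Lemma sbr_graded i j x y : subalg_hcomp i x -> subalg_hcomp j y ->
  subalg_hcomp (i (+) j) (sbr x y).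
Proof. exact: sbracket_graded. Qed.

Lemma sbr_skew i j x y : subalg_hcomp i x -> subalg_hcomp j y ->
  sbr x y = - ((-1) ^+ (i && j) *: sbr y x).
Proof.
by move=> xi yj; apply: subalg_val_inj; rewrite subalg_valN subalg_valZ !subalg_valM -sbracket_skew.
Qed.

Lemma sbr_jacobi i j x y z : subalg_hcomp i x -> subalg_hcomp j y ->
  sbr x (sbr y z) = sbr (sbr x y) z + (-1) ^+ (i && j) *: sbr y (sbr x z).
Proof.
move=> xi yj; apply: subalg_val_inj.
by rewrite subalg_valD subalg_valZ !subalg_valM (sbracket_jacobi _ xi yj).
Qed.

Lemma sbr_cube x : subalg_hcomp true x -> sbr x (sbr x x) = 0.
Proof. by move=> x1; apply: subalg_val_inj; rewrite subalg_val0; apply: sbracket_cube. Qed.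

HB.instance Definition _ := Lmodule_isLieSuperalgebra.Build K subalg
  subalg_hcomp_submod subalg_hcomp_decomp subalg_hcomp_direct sbrDl sbrDr
  sbr_graded sbr_skew sbr_jacobi sbr_cube.

End SubalgebraType.

(** The universal property gives a homomorphism from F to the subalgebra S that
fixes the generators; composed with the inclusion it is the identity, by
uniqueness, so every element of F lies in S. *)
Lemma free_ind (K : fieldType) (F : lieSuperType K) (X : Type)
    (par : X -> bool) (inc : X -> F) (S : subalgebra F) :
  free_on par inc -> (forall x, (S : set F) (inc x)) ->
  forall x, (S : set F) x.
Proof.
move=> [parP univ] Sinc x.
have [f [[fhom finc] _]] :=
  univ (subalg S) (fun x => subalg_mk (Sinc x)) parP.
have [h [_ huniq]] := univ F inc parP.
have idE : h = id by apply: huniq.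
have subalg_valE : h = (fun x => subalg_val (f x)).
  apply: huniq; split=> [|y]; last by rewrite finc.
  case: fhom => flin fgr fbr; split=> [a y y'|i y yi|y y'].
  - by rewrite flin subalg_valP.
  - exact: (fgr i y yi).
  - by rewrite fbr.
by rewrite -[x]/(id x) -idE subalg_valE; apply: subalg_val_mem.
Qed.

(** * General linear Lie superalgebras *)

(** The parity p of the indices appears in the name of the type only: it selects
the grading and the bracket carried by the matrices. *)
Definition glsuper (K : fieldType) (n : nat) (p : 'I_n.+1 -> bool) : Type :=
  'M[K]_n.+1.

Section GeneralLinear.
Context (K : fieldType) (n : nat) (p : 'I_n.+1 -> bool).
Implicit Types A B C : 'M[K]_n.+1.

HB.instance Definition _ := GRing.Lmodule.on (glsuper K p).

Definition gl_hcomp (i : bool) : set (glsuper K p) :=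
  fun A => forall s t, p s (+) p t != i -> A s t = 0.

Definition gl_part (i : bool) A : 'M[K]_n.+1 :=
  \matrix_(s, t) if p s (+) p t == i then A s t else 0.

(** The supercommutator of arbitrary matrices, written through the homogeneous
parts; on homogeneous arguments it is gl_bracketE. *)
Definition gl_bracket (A B : glsuper K p) : glsuper K p :=
  (A : 'M_n.+1) * B - gl_part false B * A
    - gl_part true B * (gl_part false A - gl_part true A).

Lemma gl_part_hcomp i A : gl_hcomp i (gl_part i A).
Proof. by move=> s t /negPf pE; rewrite mxE pE. Qed.

Lemma gl_part_sum A : A = gl_part false A + gl_part true A.
Proof.
by apply/matrixP=> s t; rewrite !mxE; case: (p s (+) p t); rewrite ?addr0 ?add0r.
Qed.

Lemma gl_partP i a A B : gl_part i (a *: A + B) = a *: gl_part i A + gl_part i B.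
Proof.
by apply/matrixP=> s t; rewrite !mxE; case: ifP; rewrite ?mulr0 ?addr0.
Qed.

Lemma gl_part_id i j A : gl_hcomp i A ->
  gl_part j A = if i == j then A else 0.
Proof.
move=> Ai; apply/matrixP=> s t; rewrite mxE.
case: eqVneq => [ps|ps].
  by case: eqVneq => [//|ij]; rewrite mxE Ai // ps eq_sym.
by case: eqVneq => [ij|_]; rewrite ?mxE // Ai // ij.
Qed.

Lemma gl_hcomp_submod i : submodule (gl_hcomp i).
Proof.
split=> [ s t _|a u v ui vi s t st]; first by rewrite mxE.
by rewrite !mxE ui // vi // mulr0 addr0.
Qed.

Lemma gl_hcomp_decomp (A : glsuper K p) : exists A0 A1 : glsuper K p,
  [/\ gl_hcomp false A0, gl_hcomp true A1 & A = A0 + A1].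
Proof.
exists (gl_part false A), (gl_part true A).
by split; [apply: gl_part_hcomp..|apply: gl_part_sum].
Qed.

Lemma gl_hcomp_direct A : gl_hcomp false A -> gl_hcomp true A -> A = 0.
Proof.
move=> A0 A1; apply/matrixP=> s t; rewrite mxE.
by case: (boolP (p s (+) p t)) => pst; [apply: A0|apply: A1];
  rewrite ?pst // (negPf pst).
Qed.

Lemma gl_bracketDl a x y z :
  gl_bracket (a *: x + y) z = a *: gl_bracket x z + gl_bracket y z.
Proof.
rewrite /gl_bracket !gl_partP.
rewrite -!mulmxE !(mulmxDl, mulmxDr, mulmxN, =^~ scalemxAl, =^~ scalemxAr).
by apply/matrixP=> s t; rewrite !mxE; ring.
Qed.

Lemma gl_bracketDr a x y z :
  gl_bracket z (a *: x + y) = a *: gl_bracket z x + gl_bracket z y.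
Proof.
rewrite /gl_bracket !gl_partP.
rewrite -!mulmxE !(mulmxDl, mulmxDr, mulmxN, =^~ scalemxAl, =^~ scalemxAr).
by apply/matrixP=> s t; rewrite !mxE; ring.
Qed.

Lemma gl_bracketE i j A B : gl_hcomp i A -> gl_hcomp j B ->
  gl_bracket A B = A * B - (-1) ^+ (i && j) *: (B * A).
Proof.
move=> Ai Bj; rewrite /gl_bracket !(gl_part_id _ Ai) !(gl_part_id _ Bj).
case: i j Ai Bj => [] [] _ _ /=;
  by rewrite ?(mul0r, mulr0, subr0, sub0r, mulrN, opprK, scale1r, scaleN1r, expr1, expr0).
Qed.

Lemma gl_mul_hcomp i j A B : gl_hcomp i A -> gl_hcomp j B ->
  gl_hcomp (i (+) j) (A * B).
Proof.
move=> Ai Bj s t st; rewrite -mulmxE mxE big1 // => u _.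
have [su|su] := eqVneq (p s (+) p u) i; last by rewrite Ai // mul0r.
rewrite Bj ?mulr0 //; apply: contra st => /eqP <-; rewrite -su.
by case: (p s); case: (p u); case: (p t).
Qed.

Lemma gl_graded i j A B : gl_hcomp i A -> gl_hcomp j B ->
  gl_hcomp (i (+) j) (gl_bracket A B).
Proof.
move=> Ai Bj; rewrite (gl_bracketE Ai Bj) addrC -scaleNr.
apply: (submodP (gl_hcomp_submod _)); last exact: gl_mul_hcomp.
by rewrite addbC; apply: gl_mul_hcomp.
Qed.

Lemma gl_skew i j A B : gl_hcomp i A -> gl_hcomp j B ->
  gl_bracket A B = - ((-1) ^+ (i && j) *: gl_bracket B A).
Proof.
move=> Ai Bj; rewrite (gl_bracketE Ai Bj) (gl_bracketE Bj Ai) [j && i]andbC.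
rewrite scalerBr scalerA -expr2 sqrr_sign scale1r.
by rewrite opprB addrC.
Qed.

Lemma gl_jacobi i j A B C : gl_hcomp i A -> gl_hcomp j B ->
  gl_bracket A (gl_bracket B C) = gl_bracket (gl_bracket A B) C
    + (-1) ^+ (i && j) *: gl_bracket B (gl_bracket A C).
Proof.
have hom h D : gl_hcomp i A -> gl_hcomp j B -> gl_hcomp h D ->
  gl_bracket A (gl_bracket B D) = gl_bracket (gl_bracket A B) D
    + (-1) ^+ (i && j) *: gl_bracket B (gl_bracket A D).
  move=> Ai Bj Dh.
  rewrite (gl_bracketE Ai (gl_graded Bj Dh)) (gl_bracketE (gl_graded Ai Bj) Dh).
  rewrite (gl_bracketE Bj (gl_graded Ai Dh)).
  rewrite (gl_bracketE Ai Bj) (gl_bracketE Bj Dh) (gl_bracketE Ai Dh).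
  rewrite !(mulrBr, mulrBl) -!(scalerAl, scalerAr) !mulrA.
  apply/matrixP=> s t; rewrite !mxE.
  by case: i j h {Ai Bj Dh} => [] [] [] /=; ring.
move=> Ai Bj; rewrite [C]gl_part_sum -[gl_part false C]scale1r.
rewrite !gl_bracketDr.
rewrite (hom _ _ Ai Bj (@gl_part_hcomp false C)).
rewrite (hom _ _ Ai Bj (@gl_part_hcomp true C)).
by rewrite !scale1r addrACA [in RHS]scalerDr.
Qed.

Lemma gl_cube A : gl_hcomp true A -> gl_bracket A (gl_bracket A A) = 0.
Proof.
move=> A1; rewrite (gl_bracketE A1 (gl_graded A1 A1)) (gl_bracketE A1 A1) /=.
by rewrite expr1 expr0 scaleN1r opprK scale1r mulrDr mulrDl mulrA subrr.
Qed.

HB.instance Definition _ := Lmodule_isLieSuperalgebra.Build K (glsuper K p)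
  gl_hcomp_submod gl_hcomp_decomp gl_hcomp_direct gl_bracketDl gl_bracketDr
  gl_graded gl_skew gl_jacobi gl_cube.

End GeneralLinear.

(** * Homomorphisms, linear forms and sums *)

Section Homomorphism.
Context (K : fieldType) (L M : lieSuperType K) (f : L -> M).
Hypothesis fhom : lie_shom f.

Lemma shomP a x y : f (a *: x + y) = a *: f x + f y.
Proof. by case: fhom. Qed.

Lemma shom0 : f 0 = 0.
Proof. by have := shomP (-1) 0 0; rewrite scaler0 addr0 scaleN1r addNr. Qed.

Lemma shomZ a x : f (a *: x) = a *: f x.
Proof. by rewrite -[a *: x]addr0 shomP shom0 addr0. Qed.

Lemma shomD x y : f (x + y) = f x + f y.
Proof. by rewrite -[x in LHS]scale1r shomP scale1r. Qed.

Lemma shomN x : f (- x) = - f x.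
Proof. by rewrite -scaleN1r shomZ scaleN1r. Qed.

Lemma shomB x y : f (x - y) = f x - f y.
Proof. by rewrite shomD shomN. Qed.

Lemma shomM x y : f [s x, y] = [s f x, f y].
Proof. by case: fhom. Qed.

Lemma shom_hcomp i x : hcomp i x -> hcomp i (f x).
Proof. by case: fhom => _ + _; apply. Qed.
End Homomorphism.

Section LinearForm.
Context (K : fieldType) (V : lmodType K) (phi : V -> K).
Hypothesis philin : forall a x y, phi (a *: x + y) = a * phi x + phi y.

Lemma lform0 : phi 0 = 0.
Proof. by have := philin (-1) 0 0; rewrite scaler0 addr0 mulN1r addNr. Qed.

Lemma lformZ a x : phi (a *: x) = a * phi x.
Proof. by rewrite -[a *: x]addr0 philin lform0 addr0. Qed.

Lemma lformD x y : phi (x + y) = phi x + phi y.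
Proof. by rewrite -[x in LHS]scale1r philin mul1r. Qed.

Lemma lform_sum (I : Type) (r : seq I) (P : pred I) (F : I -> V) :
  phi (\sum_(i <- r | P i) F i) = \sum_(i <- r | P i) phi (F i).
Proof. exact: (big_morph phi lformD lform0). Qed.
End LinearForm.

Lemma submod_sum (K : fieldType) (L : lieSuperType K) (S : set L) (I : Type)
    (r : seq I) (P : pred I) (F : I -> L) :
  submodule S -> (forall i, P i -> S (F i)) -> S (\sum_(i <- r | P i) F i).
Proof.
move=> subS SF; elim/big_ind: _ => //; first exact: submod0.
exact: submodD.
Qed.
Arguments submod_sum {K L S I r P F}.


Section BracketSum.
Context (K : fieldType) (L : lieSuperType K).

Lemma sbracketZl a (x y : L) : [s a *: x, y] = a *: [s x, y].
Proof. by have := sbracketDl a x 0 y; rewrite addr0 sbracket0l addr0. Qed.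

Lemma sbracketZr a (x y : L) : [s y, a *: x] = a *: [s y, x].
Proof. by have := sbracketDr a x 0 y; rewrite addr0 sbracket0r addr0. Qed.

Lemma sbracketNl (x y : L) : [s - x, y] = - [s x, y].
Proof. by rewrite -scaleN1r sbracketZl scaleN1r. Qed.

Context (I : Type) (r : seq I).

Lemma sbracket_suml (a : I -> K) (x : I -> L) y :
  [s \sum_(i <- r) a i *: x i, y] = \sum_(i <- r) a i *: [s x i, y].
Proof.
elim: r => [|i s IHs]; first by rewrite !big_nil sbracket0l.
by rewrite !big_cons sbracketDl IHs.
Qed.

Lemma sbracket_sumr (a : I -> K) (x : I -> L) y :
  [s y, \sum_(i <- r) a i *: x i] = \sum_(i <- r) a i *: [s y, x i].
Proof.
elim: r => [|i s IHs]; first by rewrite !big_nil sbracket0r.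
by rewrite !big_cons sbracketDr IHs.
Qed.
End BracketSum.

(** * Adapted bases *)

(** Coordinates for a Lie superalgebra whose derived subalgebra lies in a central
line: the v_i complete z to a homogeneous basis, c and d are the coordinate
forms, and beta is the matrix of the bracket. *)
Record adapted_basis (K : fieldType) (L : lieSuperType K) (N : nat)
    (prt : 'I_N -> bool) (beta : 'I_N -> 'I_N -> K) := AdaptedBasis {
  ab_v : 'I_N -> L;
  ab_z : L;
  ab_c : 'I_N -> L -> K;
  ab_d : L -> K;
  ab_v_hcomp : forall i, hcomp (prt i) (ab_v i);
  ab_z_hcomp : hcomp true ab_z;
  ab_cP : forall i a x y, ab_c i (a *: x + y) = a * ab_c i x + ab_c i y;
  ab_dP : forall a x y, ab_d (a *: x + y) = a * ab_d x + ab_d y;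
  ab_decomp : forall x, x = \sum_i ab_c i x *: ab_v i + ab_d x *: ab_z;
  ab_c_hcomp : forall i x, hcomp (~~ prt i) x -> ab_c i x = 0;
  ab_d_hcomp : forall x, hcomp false x -> ab_d x = 0;
  ab_cv : forall i j, ab_c i (ab_v j) = (i == j)%:R;
  ab_dv : forall i, ab_d (ab_v i) = 0;
  ab_cz : forall i, ab_c i ab_z = 0;
  ab_dz : ab_d ab_z = 1;
  ab_vv : forall i j, [s ab_v i, ab_v j] = beta i j *: ab_z;
  ab_zl : forall x, [s ab_z, x] = 0;
  ab_zr : forall x, [s x, ab_z] = 0
}.

Section AdaptedBracket.
Context (K : fieldType) (L : lieSuperType K) (N : nat) (prt : 'I_N -> bool).
Context (beta : 'I_N -> 'I_N -> K) (b : adapted_basis L prt beta).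

Lemma ab_bracket x y : [s x, y] =
  (\sum_i \sum_j ab_c b i x * (ab_c b j y * beta i j)) *: ab_z b.
Proof.
rewrite [in LHS](ab_decomp b x) [in LHS](ab_decomp b y).
rewrite sbracketAr sbracketZr ab_zr scaler0 addr0.
rewrite sbracketAl sbracketZl ab_zl scaler0 addr0.
rewrite sbracket_suml scaler_suml; apply: eq_bigr => i _.
rewrite sbracket_sumr scaler_sumr scaler_suml; apply: eq_bigr => j _.
by rewrite ab_vv !scalerA mulrA.
Qed.
End AdaptedBracket.

(** * Matrix representations that kill [[R, F], F] *)

Section Degree.
Context (K : fieldType) (n : nat).
Implicit Types A B C : 'M[K]_n.+1.

(** Matrices whose entries vanish strictly below the d-th superdiagonal; they
filter the upper triangular matrices as powers of the augmentation ideal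
filter a tensor algebra. *)
Definition gl_deg (d : nat) : set 'M[K]_n.+1 :=
  fun A => forall s t : 'I_n.+1, (t < s + d)%N -> A s t = 0.

Lemma gl_deg_le d e A : (d <= e)%N -> gl_deg e A -> gl_deg d A.
Proof. by move=> de Ae s t st; apply: Ae; lia. Qed.

Lemma gl_deg_eq0 d A : (n < d)%N -> gl_deg d A -> A = 0.
Proof. by move=> nd Ad; apply/matrixP=> s t; rewrite mxE Ad //; have := ltn_ord t; lia. Qed.

Lemma gl_deg_mul a b A B : gl_deg a A -> gl_deg b B -> gl_deg (a + b) (A * B).
Proof.
move=> Aa Bb s t st; rewrite -mulmxE mxE big1 // => u _.
have [su|su] := ltnP u (s + a); first by rewrite Aa // mul0r.
by rewrite Bb ?mulr0 //; lia.
Qed.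

(** On the extreme superdiagonal of a product only one path contributes. *)
Lemma gl_deg_lead a b A B s : gl_deg a A -> gl_deg b B -> (s + a + b <= n)%N ->
  (A * B) (inord s) (inord (s + a + b)) =
  A (inord s) (inord (s + a)) * B (inord (s + a)) (inord (s + a + b)).
Proof.
move=> Aa Bb sn; rewrite -mulmxE mxE (bigD1 (inord (s + a))) //= big1 ?addr0 //.
move=> u; have [su|su] := ltnP u (s + a).
  by rewrite Aa ?mul0r // inordK //; lia.
move=> /eqP us; rewrite Bb ?mulr0 // inordK; last by lia.
suff: (u : nat) <> (s + a)%N by lia.
by move=> uE; apply: us; rewrite -uE inord_val.
Qed.

Context (p : 'I_n.+1 -> bool).

Lemma gl_deg_submod d : submodule (gl_deg d : set (glsuper K p)).
Proof.
split=> [ s t _|a u v ud vd s t st]; first by rewrite mxE.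
by rewrite !mxE ud // vd // mulr0 addr0.
Qed.

Lemma gl_deg_part d i A : gl_deg d A -> gl_deg d (gl_part p i A).
Proof. by move=> Ad s t st; rewrite mxE Ad // if_same. Qed.

Lemma gl_deg_bracket a b (A B : glsuper K p) :
  gl_deg a A -> gl_deg b B -> gl_deg (a + b) [s A, B].
Proof.
move=> Aa Bb; have subG := gl_deg_submod.
apply: (submodB (subG _)); last first.
  rewrite addnC; apply: gl_deg_mul; first exact: gl_deg_part.
  by apply: (submodB (subG _)); apply: gl_deg_part.
apply: (submodB (subG _)); first exact: gl_deg_mul.
by rewrite addnC; apply: gl_deg_mul => //; apply: gl_deg_part.
Qed.
End Degree.

Section Representation.
Context (K : fieldType) (L : lieSuperType K) (N : nat) (prt : 'I_N -> bool).
Context (beta : 'I_N -> 'I_N -> K) (b : adapted_basis L prt beta).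
Context (F : lieSuperType K) (X : Type) (par : X -> bool) (inc : X -> F).
Hypothesis Ffree : free_on par inc.
Context (q : F -> L) (qhom : lie_shom q).
Context (d : nat) (p : 'I_d.+2 -> bool).
Context (e : 'I_N -> glsuper K p) (w : glsuper K p).
Hypothesis e_hcomp : forall i, hcomp (prt i) (e i).
Hypothesis e_deg : forall i, gl_deg 1 (e i).
Hypothesis w_hcomp : hcomp true w.
Hypothesis d_gt1 : (1 < d)%N.
Hypothesis w_deg : gl_deg d.-1 w.
Hypothesis ee : forall i j, gl_deg d ([s e i, e j] - beta i j *: w).

(** The candidate for the image of x modulo degree d. *)
Let ap (x : F) : glsuper K p :=
  \sum_i ab_c b i (q x) *: e i + ab_d b (q x) *: w.

Let apP a x y : ap (a *: x + y) = a *: ap x + ap y.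
Proof.
rewrite /ap (shomP qhom) ab_dP scalerDr addrACA scaler_sumr -big_split /=.
congr (_ + _); last by rewrite scalerDl scalerA.
by apply: eq_bigr => i _; rewrite ab_cP scalerDl scalerA.
Qed.

Let ap_hcomp i x : hcomp i x -> hcomp i (ap x).
Proof.
move=> xi; apply: (submodD (hcomp_submod i)).
  elim/big_ind: _ => [|u v|j _]; first exact: (submod0 (hcomp_submod i)).
    exact: (submodD (hcomp_submod i)).
  have [<-|ij] := eqVneq (prt j) i.
    exact: (submodZ (hcomp_submod _)).
  rewrite ab_c_hcomp ?scale0r; first exact: (submod0 (hcomp_submod _)).
  by rewrite (_ : ~~ prt j = i); [apply: shom_hcomp|case: (prt j) i ij {xi} => [] []].
case: i xi => xi; first exact: (submodZ (hcomp_submod _)).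
rewrite ab_d_hcomp ?scale0r; first exact: (submod0 (hcomp_submod _)).
exact: shom_hcomp.
Qed.

Let ap_deg x : gl_deg 1 (ap x).
Proof.
apply: (submodD (gl_deg_submod _ _ _)).
  elim/big_ind: _ => [|u v|i _]; first exact: (submod0 (gl_deg_submod _ _ _)).
    exact: (submodD (gl_deg_submod _ _ _)).
  exact: (submodZ (gl_deg_submod _ _ _)).
apply: (submodZ (gl_deg_submod _ _ _)); apply: gl_deg_le w_deg; lia.
Qed.

(** The terms that contain w have degree at least d, since d > 1, and the others
agree by the hypothesis on [e i, e j]. *)
Let ap_bracket x y : gl_deg d ([s ap x, ap y] - ap [s x, y]).
Proof.
have subG := gl_deg_submod K p d.
have ->: ap [s x, y] =
    (\sum_i \sum_j ab_c b i (q x) * (ab_c b j (q y) * beta i j)) *: w.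
  rewrite /ap (shomM qhom) (ab_bracket b) lformZ; last exact: ab_dP.
  rewrite ab_dz mulr1 big1 ?add0r // => i _.
  by rewrite lformZ ?ab_cz ?mulr0 ?scale0r //; apply: ab_cP.
rewrite /ap; set dx := ab_d b (q x); set dy := ab_d b (q y).
have wdeg1 : gl_deg 1 w by apply: gl_deg_le w_deg; lia.
rewrite sbracketAr sbracketZr sbracketAl sbracketZl.
set sx := \sum_i _ *: e i; set sy := \sum_i ab_c b i (q y) *: e i.
have sx1 : gl_deg 1 sx.
  have := ap_deg x; rewrite /ap -/sx -/dx => sx1.
  rewrite -[sx](addrK (dx *: w)); apply: (submodB (gl_deg_submod _ p _)) => //.
  exact: (submodZ (gl_deg_submod _ p _)).
have sy1 : gl_deg 1 sy.
  have := ap_deg y; rewrite /ap -/sy -/dy => sy1.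
  rewrite -[sy](addrK (dy *: w)); apply: (submodB (gl_deg_submod _ p _)) => //.
  exact: (submodZ (gl_deg_submod _ p _)).
have wl (t : glsuper K p) : gl_deg 1 t -> gl_deg d [s w, t].
  move=> t1; apply: (@gl_deg_le _ _ _ (d.-1 + 1)); first by lia.
  exact: gl_deg_bracket.
have wr (t : glsuper K p) : gl_deg 1 t -> gl_deg d [s t, w].
  move=> t1; apply: (@gl_deg_le _ _ _ (1 + d.-1)); first by lia.
  exact: gl_deg_bracket.
rewrite addrAC; apply: (submodD subG); last first.
  apply: (submodZ subG); rewrite sbracketAl sbracketZl.
  apply: (submodD subG); first exact: wr.
  by apply: (submodZ subG); apply: wl.
rewrite addrAC; apply: (submodD subG); last by apply: (submodZ subG); apply: wl.
rewrite /sx sbracket_suml scaler_suml -sumrB.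
elim/big_ind: _ => [|u v|i _]; first exact: (submod0 subG).
  exact: (submodD subG).
rewrite /sy sbracket_sumr scaler_sumr scaler_suml -sumrB.
elim/big_ind: _ => [|u v|j _]; first exact: (submod0 subG).
  exact: (submodD subG).
rewrite mulrA -!scalerA -!scalerBr.
by do 2!apply: (submodZ subG).
Qed.

Let J : set F := gcomm (gcomm (gker qhom) (gfull F)) (gfull F).

(** For r in the kernel of q the approximation ap r vanishes, so f r has degree
d; each of the two brackets adds 1, and matrices of size d + 2 have no nonzero
element of degree d + 2. *)
Let kill (f : F -> glsuper K p) : lie_shom f ->
  (forall x, gl_deg d (f x - ap x)) -> forall x, J x -> f x = 0.
Proof.
move=> fhom fap.
have f1 x : gl_deg 1 (f x).
  rewrite -[f x](subrK (ap x)); apply: (submodD (gl_deg_submod _ p _)) => //.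
  by apply: gl_deg_le (fap x); lia.
have sub m : submodule [set x | gl_deg m (f x)].
  split=> [|a u v] /=; first by rewrite (shom0 fhom); case: (gl_deg_submod K p m).
  by rewrite (shomP fhom); apply: (submodP (gl_deg_submod K p m)).
have step m (R : set F) : (forall x, R x -> gl_deg m (f x)) ->
    forall x, scomm R setT x -> gl_deg m.+1 (f x).
  move=> Rm x; apply: (smallest_sub (sub m.+1)) => _ [y Ry [z _ <-]] /=.
  rewrite (shomM fhom); apply: (@gl_deg_le _ _ _ (m + 1)); first by rewrite addn1.
  by apply: gl_deg_bracket => //; apply: Rm.
move=> x Jx; apply: (@gl_deg_eq0 K d.+1 d.+2) => //.
apply: (step _ _ _ x Jx); apply: step => y /= qy0.
have := fap y; rewrite /ap qy0 big1 => [|i _]; last first.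
  by rewrite (lform0 (ab_cP b i)) scale0r.
by rewrite (lform0 (ab_dP b)) scale0r addr0 subr0.
Qed.

(** Freeness extends ap from the generators to a homomorphism f.  The set where
f and ap agree modulo degree d is a subalgebra because ap is multiplicative
modulo degree d; as it contains the generators, it is everything. *)
Lemma representation : exists f : F -> glsuper K p, [/\ lie_shom f,
  forall x, gl_deg d (f x - (\sum_i ab_c b i (q x) *: e i + ab_d b (q x) *: w))
  & forall x, J x -> f x = 0].
Proof.
have [parP univ] := Ffree.
have [|f [[fhom finc] _]] := univ (glsuper K p) (fun x => ap (inc x)).
  by move=> x; apply: ap_hcomp.
suff fap : forall x, gl_deg d (f x - ap x) by exists f; split=> //; apply: kill.
have subG := gl_deg_submod K p d.
pose S : set F := fun x => gl_deg d (f x - ap x).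
have subS : submodule S.
  split=> [|a u v Su Sv].
    have ap0 : ap 0 = 0.
      by have := apP (-1) 0 0; rewrite scaler0 addr0 scaleN1r addNr.
    by rewrite /S (shom0 fhom) ap0 subrr; apply: (submod0 subG).
  rewrite /S (shomP fhom) apP opprD addrACA -scalerBr.
  exact: (submodP subG).
have apD x y : ap (x + y) = ap x + ap y.
  by rewrite -[x in LHS]scale1r apP scale1r.
have grS : graded S.
  move=> x Sx; have [x0 [x1 [x00 x11 xE]]] := hcomp_decomp x.
  exists x0, x1.
  have part i u v : hcomp i u -> hcomp (~~ i) v -> S (u + v) -> S u.
    move=> ui vi /(@gl_deg_part K d.+1 p d i).
    rewrite /S (shomD fhom) apD opprD addrACA.
    have hu : hcomp i (f u - ap u).
      apply: (submodB (hcomp_submod i)); last exact: ap_hcomp.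
      exact: shom_hcomp.
    have hv : hcomp (~~ i) (f v - ap v).
      apply: (submodB (hcomp_submod _)); last exact: ap_hcomp.
      exact: shom_hcomp.
    rewrite -[f u - ap u in X in X -> _]scale1r gl_partP scale1r.
    rewrite (gl_part_id _ hu) (gl_part_id _ hv) eqxx.
    by rewrite (_ : (~~ i == i) = false) ?addr0 //; case: (i).
  split=> //; split=> //; first by apply: (part false) x11 _; rewrite -?xE.
  by apply: (part true) x00 _; rewrite // addrC -xE.
have brS x y : S x -> S y -> S [s x, y].
  move=> Sx Sy; rewrite /S (shomM fhom).
  rewrite -[X in _ - X](subrK [s ap x, ap y]) -[ap [s x, y] - _]opprB opprD opprK.
  rewrite addrA addrAC.
  apply: (submodD subG); last exact: ap_bracket.
  rewrite -[f x](subrK (ap x)) sbracketAl.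
  rewrite -addrA -sbracketBr.
  have degf z : S z -> gl_deg 1 (f z).
    move=> Sz; rewrite -[f z](subrK (ap z)).
    apply: (submodD (gl_deg_submod _ _ _)) => //.
    by apply: gl_deg_le Sz; lia.
  apply: (submodD subG).
    by apply: (gl_deg_le (leq_addr 1 d)); apply: gl_deg_bracket => //; apply: degf.
  by apply: (gl_deg_le (leq_addl 1 d)); apply: gl_deg_bracket.
apply: (free_ind (S := Subalgebra subS grS brS) Ffree) => y /=.
by rewrite /S finc subrr; apply: (submod0 subG).
Qed.
End Representation.

(** * Coefficients of words *)

Section LeadingEntries.
Context (K : fieldType) (n : nat) (p : 'I_n.+1 -> bool).

Definition gl_at (A : 'M[K]_n.+1) (s t : nat) : K := A (inord s) (inord t).

Lemma gl_at_bracket i j d (A B : glsuper K p) s t :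
  hcomp i A -> hcomp j B -> gl_deg d A -> gl_deg 1 B ->
  t = (s + d)%N -> (t < n)%N ->
  gl_at [s A, B] s t.+1 = gl_at A s t * gl_at B t t.+1
    - (-1) ^+ (i && j) * (gl_at B s s.+1 * gl_at A s.+1 t.+1).
Proof.
move=> Ai Bj Ad B1 tE tn.
have entry (X Y : 'M[K]_n.+1) a u v : (X - a *: Y) u v = X u v - a * Y u v.
  by rewrite !mxE.
rewrite [X in gl_at X _ _](gl_bracketE Ai Bj) /gl_at entry.
have := gl_deg_lead (s := s) Ad B1; rewrite addn1 -tE => -> //.
have := gl_deg_lead (s := s) B1 Ad; rewrite -addnA add1n addnS -tE addn1.
by move=> ->.
Qed.
End LeadingEntries.

Section WordCoefficient.
Context (K : fieldType) (N : nat) (prt : 'I_N -> bool) (w : nat -> 'I_N).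

(** wcoef2, wcoef3 and wcoef4 are the coefficients of the factor of w that
starts at position s in the left-normed supercommutators of two, three and
four letters, computed in the free associative superalgebra. *)
Definition wcoef1 i s : K := (w s == i)%:R.

Definition wcoef2 i j s : K := wcoef1 i s * wcoef1 j s.+1
  - (-1) ^+ (prt i && prt j) * (wcoef1 j s * wcoef1 i s.+1).

Definition wcoef3 i j h s : K := wcoef2 i j s * wcoef1 h s.+2
  - (-1) ^+ ((prt i (+) prt j) && prt h) * (wcoef1 h s * wcoef2 i j s.+1).

Definition wcoef4 i j h m s : K := wcoef3 i j h s * wcoef1 m s.+3
  - (-1) ^+ ((prt i (+) prt j (+) prt h) && prt m)
    * (wcoef1 m s * wcoef3 i j h s.+1).

(** Positions are graded by the parity of the prefix of w before them, so that
each letter acts by a homogeneous matrix of its own parity. *)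
Definition word_par (s : nat) : bool := \big[addb/false]_(u < s) prt (w u).

Context (n : nat).
Definition word_gl := glsuper K (fun s : 'I_n.+1 => word_par s).

Definition word_gen i : word_gl :=
  \matrix_(s, t) (((t : nat) == s.+1) && (w s == i))%:R.

Lemma word_gen_hcomp i : hcomp (prt i) (word_gen i).
Proof.
move=> s t st; rewrite mxE; case: eqP => //= tE; case: eqP => //= wsE.
by move: st; rewrite tE /word_par big_ord_recr /= addbA addbb addFb wsE eqxx.
Qed.

Lemma word_gen_deg i : gl_deg 1 (word_gen i).
Proof. by move=> s t st; rewrite mxE; case: eqP => //; lia. Qed.

Lemma word_gen_at i s : (s < n)%N -> gl_at (word_gen i) s s.+1 = wcoef1 i s.
Proof. by move=> sn; rewrite /gl_at mxE !inordK ?eqxx //; lia. Qed.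
End WordCoefficient.

Section WordForms.
Context (K : fieldType) (L : lieSuperType K) (N : nat) (prt : 'I_N -> bool).
Context (beta : 'I_N -> 'I_N -> K) (b : adapted_basis L prt beta).
Context (F : lieSuperType K) (X : Type) (par : X -> bool) (inc : X -> F).
Hypothesis Ffree : free_on par inc.
Context (q : F -> L) (qhom : lie_shom q).
Context (g : 'I_N -> F).
Hypothesis g_hcomp : forall i, hcomp (prt i) (g i).
Hypothesis g_lift : forall i, q (g i) = ab_v b i.

Let J : set F := gcomm (gcomm (gker qhom) (gfull F)) (gfull F).

Let word_rep d (w : nat -> 'I_N) (W : word_gl K prt w d.+1) :
  (1 < d)%N -> hcomp true W -> gl_deg d.-1 W ->
  (forall i j, gl_deg d ([s word_gen K prt w d.+1 i, word_gen K prt w d.+1 j]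
     - beta i j *: W)) ->
  exists f : F -> word_gl K prt w d.+1, [/\ lie_shom f,
    forall x, J x -> f x = 0, forall x, gl_deg 1 (f x) &
    forall i s, (s <= d)%N -> gl_at (f (g i)) s s.+1 = wcoef1 K w i s].
Proof.
move=> d1 W1 Wd ee.
have [f [fhom fap fJ]] := representation b Ffree qhom
  (@word_gen_hcomp K N prt w d.+1)
  (@word_gen_deg K N prt w d.+1) W1 d1 Wd ee.
exists f; split=> // [x|i s sd].
  rewrite -[f x](subrK (\sum_i ab_c b i (q x) *: word_gen K prt w d.+1 i
    + ab_d b (q x) *: W)).
  have subG := gl_deg_submod K (fun s : 'I_d.+2 => word_par prt w s) 1.
  apply: (submodD subG); first by apply: gl_deg_le (fap x); lia.
  apply: (submodD subG).
    elim/big_ind: _ => [|u v|i _]; first exact: (submod0 subG).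
      exact: (submodD subG).
    by apply: (submodZ subG); apply: word_gen_deg.
  by apply: (submodZ subG); apply: gl_deg_le Wd; lia.
have := fap (g i); rewrite g_lift ab_dv scale0r addr0.
rewrite (bigD1 i) //= ab_cv eqxx scale1r big1 ?addr0 => [|j /negPf ji]; last first.
  by rewrite ab_cv ji scale0r.
move=> /(_ (inord s) (inord s.+1)); rewrite !inordK; [|lia..] => H.
rewrite -(@word_gen_at K N prt w d.+1) // /gl_at; apply/eqP.
rewrite -subr_eq0; apply/eqP; rewrite -[RHS]H; last by lia.
by rewrite 2![in RHS]mxE.
Qed.

Let word_rep2 n w (f : F -> word_gl K prt w n) :
  lie_shom f -> (forall x, gl_deg 1 (f x)) ->
  (forall i s, (s < n)%N -> gl_at (f (g i)) s s.+1 = wcoef1 K w i s) ->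
  forall i j s, (s.+1 < n)%N ->
  gl_at (f [s g i, g j]) s s.+2 = wcoef2 K prt w i j s.
Proof.
move=> fhom f1 fg i j s sn.
rewrite (shomM fhom) (gl_at_bracket (d := 1) (shom_hcomp fhom (g_hcomp i))
  (shom_hcomp fhom (g_hcomp j)) (f1 _) (f1 _)) ?addn1 //.
by rewrite !fg //; lia.
Qed.

Let word_rep3 n w (f : F -> word_gl K prt w n) :
  lie_shom f -> (forall x, gl_deg 1 (f x)) ->
  (forall i s, (s < n)%N -> gl_at (f (g i)) s s.+1 = wcoef1 K w i s) ->
  forall i j h s, (s.+2 < n)%N ->
  gl_at (f [s [s g i, g j], g h]) s s.+3 = wcoef3 K prt w i j h s.
Proof.
move=> fhom f1 fg i j h s sn.
have ij := sbracket_graded (g_hcomp i) (g_hcomp j).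
have ij2 : gl_deg 2 (f [s g i, g j]).
  by rewrite (shomM fhom); apply: (@gl_deg_bracket _ _ _ 1 1).
rewrite (shomM fhom) (gl_at_bracket (shom_hcomp fhom ij)
  (shom_hcomp fhom (g_hcomp h)) ij2 (f1 _)) ?addn2 //.
by rewrite !fg // ?(word_rep2 fhom f1 fg) //; lia.
Qed.

(** In 4 by 4 matrices every product of four strictly upper triangular matrices
vanishes, so this form ignores the brackets of length four. *)
Lemma word_form3 (w : nat -> 'I_N) : exists phi : F -> K,
  [/\ forall a x y, phi (a *: x + y) = a * phi x + phi y,
      forall x, J x -> phi x = 0,
      forall i j h, phi [s [s g i, g j], g h] = wcoef3 K prt w i j h 0 &
      forall x y z t, phi [s [s [s x, y], z], t] = 0].
Proof.
have W0 : hcomp true (0 : word_gl K prt w 3) by exact: (submod0 (hcomp_submod _)).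
have [||i j|f [fhom fJ f1 fg]] := @word_rep 2 w 0 _ W0 _ _ => //.
- by case: (gl_deg_submod K (fun s : 'I_4 => word_par prt w s) 1).
- rewrite scaler0 subr0; apply: (@gl_deg_bracket _ _ _ 1 1);
  exact: word_gen_deg.
exists (fun x => gl_at (f x) 0 3); split=> [a x y|x Jx|i j h|x y z t].
- by rewrite (shomP fhom) /gl_at !mxE.
- by rewrite fJ // /gl_at mxE.
- exact: word_rep3.
- suff -> : f [s [s [s x, y], z], t] = 0 by rewrite /gl_at mxE.
  apply: (@gl_deg_eq0 _ _ 4) => //; rewrite !(shomM fhom).
  apply: (@gl_deg_bracket _ _ _ 3 1) => //; apply: (@gl_deg_bracket _ _ _ 2 1) => //.
  exact: (@gl_deg_bracket _ _ _ 1 1).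
Qed.

(** Matrices of size 5 kill J only if R is sent to degree 3, hence the need for a
matrix W that plays the role of z modulo degree 3. *)
Lemma word_form4 (w : nat -> 'I_N) (W : word_gl K prt w 4) :
  hcomp true W -> gl_deg 2 W ->
  (forall i j, gl_deg 3 ([s word_gen K prt w 4 i, word_gen K prt w 4 j]
     - beta i j *: W)) ->
  exists phi : F -> K,
  [/\ forall a x y, phi (a *: x + y) = a * phi x + phi y,
      forall x, J x -> phi x = 0 &
      forall i j h m,
        phi [s [s [s g i, g j], g h], g m] = wcoef4 K prt w i j h m 0].
Proof.
move=> W1 W2 ee; have [//|f [fhom fJ f1 fg]] := word_rep _ W1 W2 ee.
exists (fun x => gl_at (f x) 0 4); split=> [a x y|x Jx|i j h m].
- by rewrite (shomP fhom) /gl_at !mxE.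
- by rewrite fJ // /gl_at mxE.
- have ijh := sbracket_graded
    (sbracket_graded (g_hcomp i) (g_hcomp j)) (g_hcomp h).
  have ijh3 : gl_deg 3 (f [s [s g i, g j], g h]).
    rewrite !(shomM fhom).
    apply: (@gl_deg_bracket _ _ _ 2 1) => //.
    exact: (@gl_deg_bracket _ _ _ 1 1).
  rewrite (shomM fhom) (gl_at_bracket (shom_hcomp fhom ijh)
    (shom_hcomp fhom (g_hcomp m)) ijh3 (f1 _)) //.
  by rewrite !fg // !(word_rep3 fhom f1 fg).
Qed.
End WordForms.

(** * Hall triples *)

(** (i, j, h) stands for the bracket [[e_i, e_j], e_h]. *)
Definition is_hall N (t : 'I_N * 'I_N * 'I_N) : bool :=
  (t.1.2 < t.1.1)%N && (t.1.2 <= t.2)%N.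

Definition hall N : finType := {t : 'I_N * 'I_N * 'I_N | is_hall t}.

(** A word that occurs in one Hall bracket only, and there with coefficient 1 or
-1.  The natural choice j i h fails for h = j, where its two occurrences add up
to 0 or to 2 in absolute value according to parity; the word i j j is used
then, so that the characteristic does not matter. *)
Definition hall_word N (t : 'I_N * 'I_N * 'I_N) : nat -> 'I_N :=
  if (t.1.2 < t.2)%N then nth t.2 [:: t.1.2; t.1.1]
  else nth t.1.2 [:: t.1.1].

Section HallWords.
Context (K : fieldType) (N : nat) (prt : 'I_N -> bool).
Implicit Types i j h : 'I_N.

Let ltF i j : (i < j)%N -> (i == j) = false.
Proof. by move=> ij; apply/eqP => e; subst; lia. Qed.

Let gtF i j : (j < i)%N -> (i == j) = false.
Proof. by move=> ij; apply/eqP => e; subst; lia. Qed.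

Let simp := (mulr0n, mulr1n, mulr0, mul0r, mulr1, mul1r, oppr0, addr0, add0r).

Lemma hall_wcoef (t u : hall N) :
  (wcoef3 K prt (hall_word (val t)) (val u).1.1 (val u).1.2 (val u).2 0 != 0)
  = (u == t).
Proof.
case: t u => [[[i j] h] ht] [[[i' j'] h'] hu]; rewrite -[RHS]val_eqE /=.
move: ht hu; rewrite /is_hall /= => /andP[ji jh] /andP[ji' jh'].
rewrite !xpair_eqE /wcoef3 /wcoef2 /wcoef1 /hall_word /=.
case: ltnP => jh2 /=.
  have [i'E|i'j] := eqVneq j i'.
    subst i'; rewrite (gtF (i := i) (j := j')) ?(gtF (i := j) (j := j')); try lia.
    rewrite (gtF (i := h) (j := j')); last by lia.
    by rewrite (ltF (i := j') (j := j)) // andbF !simp ?eqxx.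
  have [j'E|j'j] := eqVneq j j'.
    subst j'; rewrite (gtF (i := i) (j := j)) // (gtF (i := h) (j := j)) //.
    rewrite !simp ?eqxx andbT.
    rewrite [i' == i]eq_sym [h' == h]eq_sym.
    case: (i =P i') => _; last by rewrite !simp eqxx.
    case: (h =P h') => _; last by rewrite !simp eqxx.
    by rewrite !simp oppr_eq0 signr_eq0.
  rewrite andbF.
  rewrite !simp.
  have [h'E|h'j] := eqVneq j h'; last by rewrite !simp ?eqxx.
  subst h'; have jj' : (j' < j)%N by rewrite ltn_neqAle jh' andbT eq_sym.
  rewrite (gtF (i := i) (j := j')) ?(gtF (i := h) (j := j')); try lia.
  by rewrite !simp ?eqxx.
have hE : h = j by apply/val_inj => /=; lia.
subst h.
have [i'E|i'i] := eqVneq i i'.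
  subst i'; rewrite (gtF (i := i) (j := j')) // (ltF (i := j) (j := i)) //.
  rewrite !simp ?eqxx /=.
  rewrite [h' == j]eq_sym.
  have [j'E|j'j] := eqVneq j j'; last by rewrite !simp ?eqxx.
  subst j'; rewrite !simp.
  by case: (j =P h') => _; rewrite ?eqxx // oner_eq0.
rewrite !simp.
have [j'E|j'i] := eqVneq i j'.
  subst j'; rewrite (ltF (i := j) (j := i')); last by lia.
  rewrite (ltF (i := j) (j := h')); last by lia.
  rewrite (ltF (i := j) (j := i)) // !simp.
  by rewrite ?eqxx.
have [h'E|h'i] := eqVneq i h'; last first.
  by rewrite !simp ?eqxx.
subst h'.
have [i'E|i'j] := eqVneq j i'; last by rewrite !simp ?eqxx.
subst i'; rewrite (gtF (i := j) (j := j')) //.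
by rewrite !simp ?eqxx.
Qed.
End HallWords.

(** * The two words of length four *)

Section RankOneWords.
Context (K : fieldType) (N : nat) (prt : 'I_N -> bool).
Context (x y : 'I_N) (x0 : prt x = false) (y1 : prt y = true).

Definition word_yxxx (s : nat) : 'I_N := if s == 0%N then y else x.
Definition word_xyxy (s : nat) : 'I_N := if odd s then y else x.

Let xy : (x == y) = false.
Proof. by apply/eqP => xy; move: y1; rewrite -xy x0. Qed.

Let yx : (y == x) = false. Proof. by rewrite eq_sym. Qed.

Lemma wcoef_yxxx m : (m == x) || (m == y) ->
  wcoef4 K prt word_yxxx x y x m 0 = - (m == x)%:R.
Proof.
by case/orP=> /eqP ->; rewrite /wcoef4 /wcoef3 /wcoef2 /wcoef1 /=
  /word_yxxx /= ?x0 ?y1 ?eqxx ?xy ?yx /=; ring.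
Qed.

Lemma wcoef_xyxy m : (m == x) || (m == y) ->
  wcoef4 K prt word_xyxy x y x m 0 = 2 * (m == y)%:R.
Proof.
by case/orP=> /eqP ->; rewrite /wcoef4 /wcoef3 /wcoef2 /wcoef1 /=
  /word_xyxy /= ?x0 ?y1 ?eqxx ?xy ?yx /=; ring.
Qed.

(** The entries of the square read off the factors yy of the word. *)
Lemma word_gen_sqr0 (w : nat -> 'I_N) n :
  (forall s, w s = y -> w s.+1 <> y) ->
  word_gen K prt w n y * word_gen K prt w n y = 0.
Proof.
move=> wy; apply/matrixP=> s t; rewrite -mulmxE !mxE big1 // => u _.
rewrite !mxE; case: eqP => //= us; last by rewrite mul0r.
case: eqP => //= ws; last by rewrite mul0r.
by case: eqP => //= ut; rewrite ?mulr0 // us; case: eqP => [/(wy _ ws)|]; rewrite ?mulr0.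
Qed.

Lemma word_gen_eq0 (w : nat -> 'I_N) n i :
  (forall s, w s <> i) -> word_gen K prt w n i = 0.
Proof.
move=> wi; apply/matrixP=> s t; rewrite !mxE.
by case: eqP => //= _; case: eqP => // /wi.
Qed.

(** With W = [x, y] the brackets of letters are proportional to W exactly, since
[x, x] = 0 for x even and [y, y] = 2 y^2 = 0 when the word has no factor yy. *)
Lemma word_gen_bracket (w : nat -> 'I_N) n (beta : 'I_N -> 'I_N -> K) :
  (forall s, w s = x \/ w s = y) -> (forall s, w s = y -> w s.+1 <> y) ->
  (forall i j, beta i j =
    ((i == x) && (j == y))%:R - ((i == y) && (j == x))%:R) ->
  forall i j, [s word_gen K prt w n i, word_gen K prt w n j] =
    beta i j *: [s word_gen K prt w n x, word_gen K prt w n y].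
Proof.
move=> wxy wyy betaE i j; rewrite betaE.
have out m : m != x -> m != y -> word_gen K prt w n m = 0.
  move=> /eqP mx /eqP my; apply: word_gen_eq0 => s ws.
  by case: (wxy s) => ws'; [apply: mx|apply: my]; rewrite -ws.
have ge := @word_gen_hcomp K N prt w n.
have [->|ix] := eqVneq i x.
  rewrite xy subr0 /=; have [->|jy] := eqVneq j y; first by rewrite scale1r.
  rewrite scale0r; have [->|jx] := eqVneq j x; last by rewrite (out _ jx jy) sbracket0r.
  by rewrite [LHS](gl_bracketE (ge x) (ge x)) x0 expr0 scale1r subrr.
have [->|iy] := eqVneq i y; last by rewrite (out _ ix iy) sbracket0l subrr scale0r.
rewrite sub0r /=; have [->|jx] := eqVneq j x.
  by rewrite (sbracket_skew (ge y) (ge x)) x0 y1 scaleN1r expr0 scale1r.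
rewrite oppr0 scale0r; have [->|jy] := eqVneq j y; last by rewrite (out _ jx jy) sbracket0r.
rewrite [LHS](gl_bracketE (ge y) (ge y)) word_gen_sqr0 //.
by rewrite scaler0 subr0.
Qed.
End RankOneWords.

(** * Recognising an abelian quotient *)

Section AbelianQuotient.
Context (K : fieldType) (L : lieSuperType K) (I J : gideal L).
Context (B : finType) (prt : B -> bool) (m : B -> L).
Hypothesis IJ : forall x y, (I : set L) x -> (I : set L) y -> (J : set L) [s x, y].
Hypothesis m_in : forall b, (I : set L) (m b).
Hypothesis m_hcomp : forall b, hcomp (prt b) (m b).
Hypothesis m_span : forall x, (I : set L) x ->
  exists c : B -> K, (J : set L) (x - \sum_b c b *: m b).
Hypothesis m_free : forall c : B -> K,
  (J : set L) (\sum_b c b *: m b) -> forall b, c b = 0.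

Let subJ : submodule J := gidealS (gidealP J).

Let coord_uniq x c c' : (J : set L) (x - \sum_b c b *: m b) ->
  (J : set L) (x - \sum_b c' b *: m b) -> forall b, c b = c' b.
Proof.
move=> Jc Jc' b; apply/eqP; rewrite -subr_eq0; apply/eqP.
apply: (m_free (c := fun b => c b - c' b)).
have := submodB subJ Jc' Jc.
rewrite opprB addrC addrA subrK -sumrB.
by under eq_bigr => i _ do rewrite -scalerBl.
Qed.

(** J is graded, so the part of the combination of the wrong parity lies in J by
itself and its coefficients vanish by independence. *)
Let coord_hcomp i x c : hcomp i x -> (J : set L) (x - \sum_b c b *: m b) ->
  forall b, prt b != i -> c b = 0.
Proof.
move=> xi Jx b bi.
pose e := \sum_(b | prt b == i) c b *: m b.
pose o := \sum_(b | prt b != i) c b *: m b.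
have ei : hcomp i e.
  apply: (submod_sum (hcomp_submod i)) => b' /eqP <-.
  exact: (submodZ (hcomp_submod _)).
have oi : hcomp (~~ i) o.
  apply: (submod_sum (hcomp_submod _)) => b' b'i.
  rewrite (_ : ~~ i = prt b'); first exact: (submodZ (hcomp_submod _)).
  by move: b'i; case: (prt b'); case: (i).
have {}Jx : (J : set L) (x - e - o).
  have eo : \sum_b c b *: m b = e + o by rewrite (bigID (fun b => prt b == i)).
  by rewrite -addrA -opprD -eo.
have [u [v [Ju ui Jv vi uvE]]] : exists u v,
    [/\ (J : set L) u, hcomp i u, (J : set L) v, hcomp (~~ i) v & x - e - o = u + v].
  have [u [v [[Ju u0] [Jv v1] uvE]]] := gideal_graded (gidealP J) Jx.
  case: (i); first by exists v, u; split=> //; rewrite [RHS]addrC.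
  by exists u, v.
have E : x - e - u = o + v.
  by rewrite -[x - e](subrK o) uvE addrAC [u + v]addrC addrK addrC.
have E0 : x - e - u = 0.
  have h1 : hcomp i (x - e - u).
    apply: (submodB (hcomp_submod i)) => //.
    exact: (submodB (hcomp_submod i)).
  have h2 : hcomp (~~ i) (x - e - u).
    by rewrite E; exact: (submodD (hcomp_submod (~~ i))).
  by case: (i) h1 h2 => h1 h2; apply: hcomp_direct.
(* o is the negative of an element of J. *)
have Jo : (J : set L) o.
  rewrite -[o](addrK v) -E E0 sub0r; exact: submodN.
have := m_free (c := fun b => if prt b != i then c b else 0) _ b.
rewrite bi; apply; suff <- : o = \sum_b (if prt b != i then c b else 0) *: m b by [].
by rewrite /o big_mkcond; apply: eq_bigr => b' _; case: ifP; rewrite ?scale0r.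
Qed.

Lemma squo_abelian : lie_siso (squo I J)
  (abelian_super K #|[pred b | ~~ prt b]| #|[pred b | prt b]|).
Proof.
have /choice [C CP] : forall q : squo I J, exists c : B -> K,
    (J : set L) (gval (repr q) - \sum_b c b *: m b).
  by move=> q; apply/m_span/gsubP.
have CE x c : (J : set L) (gval x - \sum_b c b *: m b) ->
    forall b, C (sproj J x) b = c b.
  move=> Jx; apply: coord_uniq (CP _) _.
  by rewrite -(subrKA (gval x)); apply: (submodD subJ) => //; apply: sproj_repr.
have CS x : (J : set L) (gval x - \sum_b C (sproj J x) b *: m b).
  rewrite -[gval x](subrK (gval (repr (sproj J x)))) -addrA.
  apply: (submodD subJ); last exact: CP.
  by rewrite -opprB; apply: (submodN subJ); apply: sproj_repr.
pose f (q : squo I J) : abelian_super K _ _ :=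
  (\row_i C q (enum_val (A := [pred b | ~~ prt b]) i),
   \row_i C q (enum_val (A := [pred b | prt b]) i)).
have finj : injective f.
  move=> q r [/rowP e0 /rowP e1].
  have CC b : C q b = C r b.
    have [pb|pb] := boolP (prt b).
      have /(_ (enum_rank_in (A := [pred b | prt b]) pb b)) := e1.
      by rewrite !mxE enum_rankK_in.
    have /(_ (enum_rank_in (A := [pred b | ~~ prt b]) pb b)) := e0.
    by rewrite !mxE enum_rankK_in.
  have [x xE] := sproj_surj q; have [y yE] := sproj_surj r; subst q r.
  apply/sproj_eq; have := submodB subJ (CS x) (CS y).
  have -> : \sum_b C (sproj J y) b *: m b = \sum_b C (sproj J x) b *: m b.
    by apply: eq_bigr => b _; rewrite CC.
  by rewrite opprB addrA subrK.
have fsurj p : exists q, f q = p.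
  pose c b := \sum_i p.1 0 i * (enum_val (A := [pred b | ~~ prt b]) i == b)%:R
    + \sum_i p.2 0 i * (enum_val (A := [pred b | prt b]) i == b)%:R.
  have Ix : (I : set L) (\sum_b c b *: m b).
    apply: (submod_sum (gidealS (gidealP I))) => b _.
    exact: (submodZ (gidealS (gidealP I))).
  pose x : gsub I := exist (fun y => gsub_pred I y) _ (asboolT Ix).
  have fE : C (sproj J x) =1 c.
    by apply: CE; rewrite /gval /= subrr; apply: (submod0 subJ).
  exists (sproj J x); rewrite /f [RHS]surjective_pairing; congr pair.
    apply/rowP => i; rewrite mxE fE /c [X in _ + X]big1 => [|j _].
      rewrite addr0 (bigD1 i) //= eqxx mulr1 big1 ?addr0 // => j /negPf ji.
      by rewrite (inj_eq enum_val_inj) ji mulr0.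
    case: eqP => ij; last by rewrite mulr0.
    by have := enum_valP i; have := enum_valP j; rewrite !inE ij => ->.
  apply/rowP => i; rewrite mxE fE /c [X in X + _]big1 => [|j _].
    rewrite add0r (bigD1 i) //= eqxx mulr1 big1 ?addr0 // => j /negPf ji.
    by rewrite (inj_eq enum_val_inj) ji mulr0.
  case: eqP => ij; last by rewrite mulr0.
  by have := enum_valP i; have := enum_valP j; rewrite !inE -ij => /negPf ->.
have /choice [g gK] := fsurj.
exists f; split; last by exists g => // q; apply: finj; rewrite gK.
split=> [a q r|i _ [x xi <-]|q r].
- have [x xE] := sproj_surj q; have [y yE] := sproj_surj r; subst q r.
  have E b : C (a *: sproj J x + sproj J y) b =
      a * C (sproj J x) b + C (sproj J y) b.
    rewrite -sprojZ -sprojD.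
    apply: (CE _ (fun b => a * C (sproj J x) b + C (sproj J y) b)).
    rewrite gvalD gvalZ.
    have := submodP subJ a (CS x) (CS y).
    rewrite scalerBr addrACA -opprD scaler_sumr -big_split /=.
    rewrite (eq_bigr (fun b => (a * C (sproj J x) b + C (sproj J y) b) *: m b)) //.
    by move=> b' _; rewrite scalerA -scalerDl.
  by congr pair; apply/rowP => j; rewrite !mxE E.
- have E := coord_hcomp xi (CS x).
  case: i xi E => xi E; apply/rowP => j; rewrite !mxE E //.
    by have := enum_valP j; rewrite inE => /negPf ->.
  by have := enum_valP j; rewrite inE => ->.
- have [x xE] := sproj_surj q; have [y yE] := sproj_surj r; subst q r.
  have E b : C [s sproj J x, sproj J y] b = 0.
    rewrite [X in C X]squo_bracketE.
    apply: (CE _ (fun _ => 0)); rewrite big1 => [|b' _]; last by rewrite scale0r.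
    by rewrite subr0 gvalM; apply: IJ; apply: gsubP.
  by congr pair; apply/rowP => j; rewrite !mxE E.
Qed.
End AbelianQuotient.

(** * Spanning sets modulo [[R, F], F] *)

Section Submodules.
Context (K : fieldType) (L : lieSuperType K) (S : set L).
Hypothesis subS : submodule S.

Lemma submod_swap i j x y : hcomp i x -> hcomp j y -> S [s y, x] -> S [s x, y].
Proof.
move=> xi yj Syx; rewrite (sbracket_skew xi yj).
by apply: (submodN subS); apply: (submodZ subS).
Qed.

Lemma submod_jacobi i j x y z : hcomp i x -> hcomp j y ->
  S [s x, [s y, z]] -> S [s y, [s x, z]] -> S [s [s x, y], z].
Proof.
move=> xi yj S1 S2.
have /eqP := sbracket_jacobi z xi yj; rewrite -subr_eq => /eqP <-.
by apply: (submodB subS) => //; apply: (submodZ subS).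
Qed.

Lemma submod_jacobir i j x y z : hcomp i x -> hcomp j y ->
  S [s [s x, y], z] -> S [s y, [s x, z]] -> S [s x, [s y, z]].
Proof.
move=> xi yj S1 S2; rewrite (sbracket_jacobi z xi yj).
by apply: (submodD subS) => //; apply: (submodZ subS).
Qed.
End Submodules.

Section HallSpan.
Context (K : fieldType) (two_neq0 : (2%:R : K) != 0) (F : lieSuperType K).
Context (N : nat) (prt : 'I_N -> bool) (g : 'I_N -> F).
Hypothesis g_hcomp : forall i, hcomp (prt i) (g i).
Context (S : set F) (subS : submodule S).

Local Notation T i j h := [s [s g i, g j], g h].

Hypothesis hallS : forall t : hall N, S (T (val t).1.1 (val t).1.2 (val t).2).

(** Skew-symmetry orders i and j; if then h < j, the Jacobi identity rewrites the
bracket through the two triples whose middle entry is h.  The Jacobi identity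
also covers i = j != h.  The bracket [[g_i, g_i], g_i] is zero: for g_i odd by
the cube axiom, and for g_i even because 2 [g_i, g_i] = 0 with 2 != 0. *)
Lemma hall_span i j h : S (T i j h).
Proof.
have hall_in (i' j' h' : 'I_N) : (j' < i')%N -> (j' <= h')%N -> S (T i' j' h').
  move=> ji jh; have H : is_hall (i', j', h') by rewrite /is_hall /= ji jh.
  by have := hallS (exist (fun t => is_hall t) _ H).
have swap (i' j' h' : 'I_N) : S (T i' j' h') -> S (T j' i' h').
  move=> ST; rewrite (sbracket_skew (g_hcomp j') (g_hcomp i')).
  by rewrite sbracketNl sbracketZl; apply: (submodN subS); apply: (submodZ subS).
have jac (i' j' h' : 'I_N) : S (T j' h' i') -> S (T i' h' j') -> S (T i' j' h').
  move=> S1 S2; apply: (submod_jacobi subS (g_hcomp i') (g_hcomp j')).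
    apply: (submod_swap subS (g_hcomp i') _ S1).
    exact: (sbracket_graded (g_hcomp j') (g_hcomp h')).
  apply: (submod_swap subS (g_hcomp j') _ S2).
  exact: (sbracket_graded (g_hcomp i') (g_hcomp h')).
have lt (i' j' h' : 'I_N) : (j' < i')%N -> S (T i' j' h').
  move=> ji; case: (leqP j' h') => jh; first exact: hall_in.
  by apply: jac; apply: hall_in => //; lia.
have [ij|ji|/val_inj <-] := ltngtP i j; [exact/swap/lt|exact: lt|].
have [ih|hi|/val_inj <-] := ltngtP i h.
- by apply: jac; apply: swap; apply: lt.
- by apply: jac; apply: lt.
case pi : (prt i) (g_hcomp i) => gi.
  apply: (submod_swap subS (sbracket_graded gi gi) gi).
  by rewrite sbracket_cube //; apply: (submod0 subS).
have /eqP := sbracket_skew gi gi; rewrite expr0 scale1r -addr_eq0 -mulr2n.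
rewrite -scaler_nat scaler_eq0 (negPf two_neq0) /= => /eqP ->.
by rewrite sbracket0l; apply: (submod0 subS).
Qed.
End HallSpan.

Section Modulo.
Context (K : fieldType) (F : lieSuperType K) (R : gideal F).

Let RF : gideal F := gcomm R (gfull F).
Let J : gideal F := gcomm RF (gfull F).
Local Notation inR x := ((R : set F) x).
Local Notation inRF x := ((RF : set F) x).
Local Notation inJ x := ((J : set F) x).

Let subR : submodule (R : set F) := gidealS (gidealP R).
Let subRF : submodule (RF : set F) := gidealS (gidealP RF).
Let subJ : submodule (J : set F) := gidealS (gidealP J).

Lemma ker_full_l r x : inR r -> inRF [s r, x].
Proof. by move=> Rr; apply: mem_scomm. Qed.

Lemma homogeneous_ind (P : F -> Prop) : (forall x y, P x -> P y -> P (x + y)) ->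
  (forall i x, hcomp i x -> P x) -> forall x, P x.
Proof.
move=> PD Ph x; have [x0 [x1 [x00 x11 ->]]] := hcomp_decomp x.
by apply: PD; [apply: Ph x00|apply: Ph x11].
Qed.

Lemma graded_homogeneous_ind (I : gideal F) (P : F -> Prop) :
  (forall x y, P x -> P y -> P (x + y)) ->
  (forall i x, (I : set F) x -> hcomp i x -> P x) ->
  forall x, (I : set F) x -> P x.
Proof.
move=> PD Ph x Ix.
have [x0 [x1 [[Ix0 x00] [Ix1 x11] ->]]] := gideal_graded (gidealP I) Ix.
by apply: PD; [apply: Ph Ix0 x00|apply: Ph Ix1 x11].
Qed.

Lemma ker_full_r r x : inR r -> inRF [s x, r].
Proof.
move=> Rr; move: r Rr x; apply: graded_homogeneous_ind => [r r' Hr Hr' x|i r Rr ri].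
  by rewrite sbracketAr; apply: (submodD subRF).
apply: homogeneous_ind => [x y Hx Hy|j x xj]; first
  by rewrite sbracketAl; apply: (submodD subRF).
exact: (submod_swap subRF xj ri (ker_full_l _ Rr)).
Qed.

Lemma comm_full_l u x : inRF u -> inJ [s u, x].
Proof. by move=> Ru; apply: mem_scomm. Qed.

Lemma comm_full_r u x : inRF u -> inJ [s x, u].
Proof.
move=> Ru; move: u Ru x; apply: graded_homogeneous_ind => [r r' Hr Hr' x|i r Rr ri].
  by rewrite sbracketAr; apply: (submodD subJ).
apply: homogeneous_ind => [x y Hx Hy|j x xj]; first
  by rewrite sbracketAl; apply: (submodD subJ).
exact: (submod_swap subJ xj ri (comm_full_l _ Rr)).
Qed.

Lemma ker_derived_l r a b : inR r -> inJ [s r, [s a, b]].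
Proof.
move=> Rr; move: r Rr a; apply: graded_homogeneous_ind => [r r' Hr Hr' a|i r Rr ri].
  by rewrite sbracketAl; apply: (submodD subJ).
apply: homogeneous_ind => [x y Hx Hy|j a aj].
  by rewrite sbracketAl sbracketAr; apply: (submodD subJ).
apply: (submod_jacobir subJ ri aj).
  by apply: comm_full_l; apply: ker_full_l.
by apply: comm_full_r; apply: ker_full_l.
Qed.

Lemma ker_derived_r r a b : inR r -> inJ [s [s a, b], r].
Proof.
move=> Rr; move: a b.
apply: homogeneous_ind => [x y Hx Hy b|i a ai].
  by rewrite 2!sbracketAl; apply: (submodD subJ).
apply: homogeneous_ind => [x y Hx Hy|j b bj].
  by rewrite sbracketAr sbracketAl; apply: (submodD subJ).
by apply: (submod_jacobi subJ ai bj); apply: comm_full_r; apply: ker_full_r.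
Qed.

Context (N : nat) (prt : 'I_N -> bool) (g : 'I_N -> F).
Hypothesis g_hcomp : forall i, hcomp (prt i) (g i).
Context (x y : 'I_N).
Let w := [s g x, g y].
Hypothesis w_hcomp : hcomp true w.
Hypothesis wR : forall a, inR [s w, a].

(** If the pair (a, b) also represents w modulo R and both entries commute with
c modulo R, then the Jacobi identity puts [[a, b], c] in [R, F]. *)
Lemma w_comm_ker i j a b c : hcomp i a -> hcomp j b ->
  inR ([s a, b] - w) -> inR [s a, c] -> inR [s b, c] -> inRF [s w, c].
Proof.
move=> ai bj abR acR bcR.
rewrite -[w](subKr [s a, b]) sbracketBl; apply: (submodB subRF).
  by apply: (submod_jacobi subRF ai bj); apply: ker_full_r.
exact: ker_full_l.
Qed.

(** From [x, [y, y]] = 2 [[x, y], y] and [y, y] in R. *)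
Lemma w_comm_odd : (2%:R : K) != 0 -> prt x = false -> prt y = true ->
  inR [s g y, g y] -> inRF [s w, g y].
Proof.
move=> two_neq0 px py yyR; have gy := g_hcomp y; rewrite py in gy.
have E : [s g x, [s g y, g y]] = 2%:R *: [s w, g y].
  rewrite (sbracket_jacobi _ (g_hcomp x) gy) px andFb expr0 scale1r.
  rewrite (sbracket_skew gy w_hcomp) expr1 scaleN1r opprK.
  by rewrite scaler_nat mulr2n.
rewrite -[[s w, g y]](scalerK two_neq0) -E.
by apply: (submodZ subRF); apply: ker_full_r.
Qed.

Lemma w_comm_span m : inR [s g x, g m] -> inRF [s w, g m] ->
  inJ [s [s w, g x], g m].
Proof.
move=> xmR wmRF; apply: (submod_jacobi subJ w_hcomp (g_hcomp x)).
  exact: ker_derived_r.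
exact: comm_full_r.
Qed.

Context (beta : 'I_N -> 'I_N -> K).
Hypothesis ggR : forall i j, inR ([s g i, g j] - beta i j *: w).
Hypothesis gwR : forall a, exists (c : 'I_N -> K) d,
  inR (a - (\sum_i c i *: g i + d *: w)).

Lemma wR' a : inR [s a, w].
Proof.
elim/homogeneous_ind: a => [u v Hu Hv|i a ai]; first
  by rewrite sbracketAl; apply: (submodD subR).
exact: (submod_swap subR ai w_hcomp (wR a)).
Qed.

Context (S : set F) (subS : submodule S).
Hypothesis JS : forall a, inJ a -> S a.
Hypothesis TS : forall i j h, S [s [s g i, g j], g h].
Hypothesis US : forall i j, S [s [s w, g i], g j].

Let gen_ind (A : set F) : submodule A -> (forall r, inR r -> A r) ->
  (forall i, A (g i)) -> A w -> forall a, A a.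
Proof.
move=> subA AR Ag Aw a; have [c [d cdR]] := gwR a.
rewrite -[a](subrK (\sum_i c i *: g i + d *: w)).
apply: (submodD subA); first exact: AR.
apply: (submodD subA); last exact: (submodZ subA).
by apply: (submod_sum subA) => i _; apply: (submodZ subA).
Qed.

Let subr a b : submodule [set c | S [s [s a, b], c]].
Proof.
by split=> [|k u v Su Sv] /=; rewrite ?sbracket0r ?sbracketDr;
  [apply: (submod0 subS)|apply: (submodP subS)].
Qed.

Let subm a c : submodule [set b | S [s [s a, b], c]].
Proof.
by split=> [|k u v Su Sv] /=; rewrite ?sbracket0r ?sbracket0l ?sbracketDr ?sbracketDl;
  [apply: (submod0 subS)|apply: (submodP subS)].
Qed.

Let subl b c : submodule [set a | S [s [s a, b], c]].
Proof.
by split=> [|k u v Su Sv] /=; rewrite ?sbracket0l ?sbracketDl ?sbracketDl;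
  [apply: (submod0 subS)|apply: (submodP subS)].
Qed.

Lemma wwRF : inRF [s w, w].
Proof.
by apply: (submod_jacobi subRF (g_hcomp x) (g_hcomp y)); apply: ker_full_r; apply: wR'.
Qed.

Lemma wwS : S [s w, w].
Proof.
apply: (submod_jacobi subS (g_hcomp x) (g_hcomp y)).
  apply: (submod_swap subS (g_hcomp x)
    (sbracket_graded (g_hcomp y) w_hcomp)).
  rewrite (sbracket_skew (g_hcomp y) w_hcomp) sbracketNl sbracketZl.
  by apply: (submodN subS); apply: (submodZ subS).
apply: (submod_swap subS (g_hcomp y)
  (sbracket_graded (g_hcomp x) w_hcomp)).
rewrite (sbracket_skew (g_hcomp x) w_hcomp) sbracketNl sbracketZl.
by apply: (submodN subS); apply: (submodZ subS).
Qed.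

(** Each entry of a triple bracket may be taken among the g_i and w.  The cases
with w in them are settled by [w, F] <= R and [R, [F, F]] <= J, apart from
[[w, g_i], g_j] itself and [w, w], which the Jacobi identity turns into two
brackets of that kind. *)
Lemma cube_span z : (lcs F 3 : set F) z -> S z.
Proof.
suff H a b c : S [s [s a, b], c].
  have sub1 c : submodule [set u | S [s u, c]].
    by split=> [|k u v Su Sv] /=; rewrite ?sbracket0l ?sbracketDl;
      [apply: (submod0 subS)|apply: (submodP subS)].
  apply: (smallest_sub subS) => _ [u Fu [c _ <-]].
  by apply: (smallest_sub (sub1 c) _ Fu) => _ [a _ [b _ <-]] /=.
apply: (gen_ind (subl b c)) => {a} /= [r Rr|i|].
- by apply: JS; apply: comm_full_l; apply: ker_full_l.
- apply: (gen_ind (subm _ c)) => {b} /= [r Rr|j|].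
  + by apply: JS; apply: comm_full_l; apply: ker_full_r.
  + apply: (gen_ind (subr _ _)) => {c} /= [r Rr|h|].
    * by apply: JS; apply: ker_derived_r.
    * exact: TS.
    * rewrite -[[s g i, g j]](subrK (beta i j *: w)) sbracketAl sbracketZl.
      apply: (submodD subS); last by apply: (submodZ subS); apply: wwS.
      by apply: JS; apply: ker_derived_l.
  + apply: (gen_ind (subr _ _)) => {c} /= [r Rr|h|].
    * by apply: JS; apply: ker_derived_r.
    * rewrite (sbracket_skew (g_hcomp i) w_hcomp) sbracketNl sbracketZl.
      by apply: (submodN subS); apply: (submodZ subS).
    * by apply: JS; apply: ker_derived_l; apply: wR'.
- apply: (gen_ind (subm _ c)) => {b} /= [r Rr|j|].
  + by apply: JS; apply: comm_full_l; apply: ker_full_r.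
  + apply: (gen_ind (subr _ _)) => {c} /= [r Rr|h|].
    * by apply: JS; apply: ker_derived_r.
    * exact: US.
    * by apply: JS; apply: ker_derived_l; apply: wR.
  + by apply: JS; apply: comm_full_l; apply: wwRF.
Qed.
End Modulo.

(** * Homogeneous bases and base change *)

Lemma has_dim_coord (K : fieldType) (V : lmodType K) (S : set V) n :
  submodule S -> has_dim S n -> exists (e : 'I_n -> V) (c : V -> 'rV[K]_n),
    [/\ forall i, S (e i), forall x, S x -> x = \sum_i c x 0 i *: e i &
        forall x (u : 'rV[K]_n), S x -> x = \sum_i u 0 i *: e i -> c x = u].
Proof.
move=> subS [e [eS ex]]; exists e.
have /choice [c cP] : forall x, exists u : 'rV[K]_n, S x ->
    x = \sum_i u 0 i *: e i /\ forall v : 'rV[K]_n, x = \sum_i v 0 i *: e i -> u = v.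
  move=> x; have [Sx|nSx] := pselect (S x); last by exists 0.
  by have [u [uE uniq]] := ex x Sx; exists u.
exists c; split=> // [x Sx|x u Sx xE]; first by case: (cP x Sx).
by have [_] := cP x Sx; apply.
Qed.

Lemma sum_delta (K : fieldType) (V : lmodType K) n (e : 'I_n -> V) i :
  \sum_j (delta_mx 0 i : 'rV[K]_n) 0 j *: e j = e i.
Proof.
rewrite (bigD1 i) //= mxE !eqxx scale1r big1 ?addr0 // => j /negPf ji.
by rewrite mxE ji andbF scale0r.
Qed.

Record graded_basis (K : fieldType) (L : lieSuperType K) (k l : nat) :=
  GradedBasis {
  gb_e0 : 'I_k -> L;
  gb_e1 : 'I_l -> L;
  gb_c0 : L -> 'rV[K]_k;
  gb_c1 : L -> 'rV[K]_l;
  gb_e0_hcomp : forall i, hcomp false (gb_e0 i);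
  gb_e1_hcomp : forall i, hcomp true (gb_e1 i);
  gb_c0P : forall a x y, gb_c0 (a *: x + y) = a *: gb_c0 x + gb_c0 y;
  gb_c1P : forall a x y, gb_c1 (a *: x + y) = a *: gb_c1 x + gb_c1 y;
  gb_decomp : forall x,
    x = \sum_i gb_c0 x 0 i *: gb_e0 i + \sum_i gb_c1 x 0 i *: gb_e1 i;
  gb_c0_odd : forall x, hcomp true x -> gb_c0 x = 0;
  gb_c1_even : forall x, hcomp false x -> gb_c1 x = 0;
  gb_c0e : forall i, gb_c0 (gb_e0 i) = delta_mx 0 i;
  gb_c1e : forall i, gb_c1 (gb_e1 i) = delta_mx 0 i
}.

Section GradedBasisTheory.
Context (K : fieldType) (L : lieSuperType K) (k l : nat).

Lemma graded_basis_exists : has_sdim (gfull L) k l ->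
  inhabited (graded_basis L k l).
Proof.
have fullE i : ((gfull L : set L) `&` hcomp i = hcomp i)%classic by rewrite setTI.
case; rewrite !fullE.
move=> /(has_dim_coord (hcomp_submod false)) [e0 [c0 [e00 d0 u0]]].
move=> /(has_dim_coord (hcomp_submod true)) [e1 [c1 [e11 d1 u1]]].
have /choice [p0 p0P] : forall x : L, exists x0, hcomp false x0 /\ hcomp true (x - x0).
  move=> x; have [x0 [x1 [x00 x11 ->]]] := hcomp_decomp x.
  by exists x0; rewrite addrC addKr.
have p0_uniq x y : hcomp false y -> hcomp true (x - y) -> p0 x = y.
  move=> y0 xy; have [x0 xx] := p0P x.
  apply/eqP; rewrite -subr_eq0; apply/eqP; apply: hcomp_direct.
    by apply: (submodB (hcomp_submod _)).
  have -> : p0 x - y = (x - y) - (x - p0 x) by rewrite opprB [RHS]addrC addrA subrK.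
  by apply: (submodB (hcomp_submod _)).
have p0P' a x y : p0 (a *: x + y) = a *: p0 x + p0 y.
  have [x0 xx] := p0P x; have [y0 yy] := p0P y.
  apply: p0_uniq; first exact: (submodP (hcomp_submod _)).
  rewrite opprD addrACA -scalerBr; exact: (submodP (hcomp_submod _)).
have p0_even x : hcomp false x -> p0 x = x.
  by move=> x0; apply: p0_uniq => //; rewrite subrr; apply: (submod0 (hcomp_submod _)).
have p0_odd x : hcomp true x -> p0 x = 0.
  by move=> x1; apply: p0_uniq; rewrite ?subr0 //; apply: (submod0 (hcomp_submod _)).
have lin n i (e : 'I_n -> L) (c : L -> 'rV[K]_n) :
    (forall x, hcomp i x -> x = \sum_j c x 0 j *: e j) ->
    (forall x (u : 'rV[K]_n), hcomp i x -> x = \sum_j u 0 j *: e j -> c x = u) ->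
    forall a x y, hcomp i x -> hcomp i y -> c (a *: x + y) = a *: c x + c y.
  move=> ce cu a x y xi yi; apply: cu; first exact: (submodP (hcomp_submod _)).
  rewrite [in LHS](ce x) // [in LHS](ce y) // scaler_sumr -big_split /=.
  by apply: eq_bigr => j _; rewrite !mxE scalerDl scalerA.
constructor; exists e0 e1 (c0 \o p0) (fun x => c1 (x - p0 x)) => //=.
- move=> a x y; rewrite p0P'; apply: (lin _ false _ _ d0 u0).
    by have [] := p0P x.
  by have [] := p0P y.
- move=> a x y; rewrite p0P' opprD addrACA -scalerBr.
  apply: (lin _ true _ _ d1 u1); first by have [] := p0P x.
  by have [] := p0P y.
- move=> x; have [x0 xx] := p0P x.
  by rewrite -d0 // -d1 // addrC subrK.
- move=> x x1; rewrite p0_odd //; apply: u0; first exact: (submod0 (hcomp_submod _)).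
  by rewrite big1 // => i _; rewrite mxE scale0r.
- move=> x x0; rewrite p0_even // subrr.
  apply: u1; first exact: (submod0 (hcomp_submod _)).
  by rewrite big1 // => i _; rewrite mxE scale0r.
- by move=> i; rewrite p0_even //; apply: u0 => //; rewrite sum_delta.
- by move=> i; rewrite p0_odd // subr0; apply: u1 => //; rewrite sum_delta.
Qed.

Context (b : graded_basis L k l) (P : 'M[K]_k) (Q : 'M[K]_l).
Hypothesis (Pu : P \in unitmx) (Qu : Q \in unitmx).

Lemma change_basis : exists b' : graded_basis L k l,
  (forall i, gb_e0 b' i = \sum_j P i j *: gb_e0 b j) /\
  (forall i, gb_e1 b' i = \sum_j Q i j *: gb_e1 b j).
Proof.
have comb n (e : 'I_n -> L) (u : 'rV[K]_n) (A : 'M[K]_n) : A \in unitmx ->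
    \sum_i (u *m invmx A) 0 i *: (\sum_j A i j *: e j) = \sum_i u 0 i *: e i.
  move=> Au; under eq_bigr => i _ do rewrite scaler_sumr.
  rewrite exchange_big; apply: eq_bigr => j _.
  rewrite -[in RHS](mulmxKV Au u) mxE scaler_suml; apply: eq_bigr => i _.
  by rewrite scalerA.
have rowV n (A : 'M[K]_n) i (u : 'rV[K]_n) :
    A \in unitmx -> u = row i A -> u *m invmx A = delta_mx 0 i.
  by move=> Au ->; rewrite -row_mul mulmxV // row1.
have coord n (c : L -> 'rV[K]_n) (e : 'I_n -> L) (A : 'M[K]_n) i :
    (forall a x y, c (a *: x + y) = a *: c x + c y) ->
    (forall j, c (e j) = delta_mx 0 j) ->
    c (\sum_j A i j *: e j) = row i A.
  move=> cP ce.
  have c0 : c 0 = 0.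
    by have := cP (-1) 0 0; rewrite scaler0 addr0 scaleN1r addNr.
  have cD x y : c (x + y) = c x + c y by rewrite -[x in LHS]scale1r cP scale1r.
  rewrite (big_morph c cD c0) [RHS]row_sum_delta; apply: eq_bigr => j _.
  by rewrite mxE -[A i j *: e j]addr0 cP c0 addr0 ce.
unshelve eexists.
  exists (fun i => \sum_j P i j *: gb_e0 b j) (fun i => \sum_j Q i j *: gb_e1 b j)
         (fun x => gb_c0 b x *m invmx P) (fun x => gb_c1 b x *m invmx Q).
  - move=> i; apply: (submod_sum (hcomp_submod false)) => j _.
    by apply: (submodZ (hcomp_submod _)); apply: gb_e0_hcomp.
  - move=> i; apply: (submod_sum (hcomp_submod true)) => j _.
    by apply: (submodZ (hcomp_submod _)); apply: gb_e1_hcomp.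
  - by move=> a x y; rewrite gb_c0P mulmxDl scalemxAl.
  - by move=> a x y; rewrite gb_c1P mulmxDl scalemxAl.
  - by move=> x; rewrite !comb //; apply: gb_decomp.
  - by move=> x x1; rewrite gb_c0_odd // mul0mx.
  - by move=> x x1; rewrite gb_c1_even // mul0mx.
  - by move=> i; apply: rowV => //; apply: coord => [|j]; [apply: gb_c0P|apply: gb_c0e].
  - by move=> i; apply: rowV => //; apply: coord => [|j]; [apply: gb_c1P|apply: gb_c1e].
by split.
Qed.
End GradedBasisTheory.

(** * Normal form of the bracket of L *)

Section DerivedLine.
Context (K : fieldType) (L : lieSuperType K).
Hypothesis L_nil : lie_nilpotent L.
Hypothesis L2_dim : has_sdim (lcs L 2) 0 1.

Lemma derived_line : exists z : L, [/\ hcomp true z, (lcs L 2 : set L) z, z != 0,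
  forall u, (lcs L 2 : set L) u -> exists a, u = a *: z &
  forall u, (lcs L 2 : set L) u -> hcomp false u -> u = 0].
Proof.
case: L2_dim => -[e0 [_ ex0]] [e1 [e1P ex1]].
have even0 u : (lcs L 2 : set L) u -> hcomp false u -> u = 0.
  by move=> Lu u0; have [|c [-> _]] := ex0 u; [split|rewrite big_ord0].
have odd1 u : (lcs L 2 : set L) u -> hcomp true u -> exists a, u = a *: e1 ord0.
  move=> Lu u1; have [|c [-> _]] := ex1 u; first by split.
  by rewrite big_ord1; exists (c 0 ord0).
exists (e1 ord0); have [Lz z1] := e1P ord0; split=> //.
- apply/eqP => z0.
  have [|c [_ uniq]] := ex1 0.
    by split; apply: submod0; [apply: gidealS (gidealP _)|apply: hcomp_submod].
  have e u : (0 : L) = \sum_i (u : 'rV[K]_1) 0 i *: e1 i.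
    by rewrite big_ord1 z0 scaler0.
  have /matrixP/(_ 0 0) := etrans (esym (uniq 0 (e 0))) (uniq (const_mx 1) (e _)).
  by rewrite !mxE => /eqP; rewrite eq_sym oner_eq0.
- move=> u Lu; have [u0 [u1 [[Lu0 u00] [Lu1 u11] ->]]] := gideal_graded (gidealP _) Lu.
  by rewrite (even0 u0) // add0r; apply: odd1.
Qed.

(** If [z, u] = a z with a != 0, then z belongs to every term of the lower
central series, against nilpotency. *)
Lemma derived_central z : (lcs L 2 : set L) z -> z != 0 ->
  (forall u, (lcs L 2 : set L) u -> exists a, u = a *: z) ->
  forall u, [s z, u] = 0.
Proof.
move=> Lz z0 line u.
have [|a zuE] := line [s z, u]; first exact: (gidealMr _ (gidealP _)).
rewrite zuE; have [->|a0] := eqVneq a 0; first by rewrite scale0r.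
have zlcs n : (lcs L n : set L) z.
  case: n => // n; elim: n => // n IHn.
  have zE : z = a^-1 *: [s z, u] by rewrite zuE scalerA mulVf // scale1r.
  rewrite zE; apply: (submodZ (gidealS (gidealP _))).
  exact: mem_scomm.
have [n lcs0] := L_nil.
by have := zlcs n; rewrite lcs0 => /= zE; rewrite zE eqxx in z0.
Qed.
End DerivedLine.

(** Indices of the adapted basis: k even vectors first, then the odd ones. *)
Definition odd_index k n (i : 'I_(k + n)) : bool := (k <= i)%N.

Definition hall_odd k n (t : 'I_(k + n) * 'I_(k + n) * 'I_(k + n)) : bool :=
  odd_index t.1.1 (+) odd_index t.1.2 (+) odd_index t.2.

(** The i-th even and the i-th odd vector are dual for i < r; the second term is
forced by skew-symmetry. *)
Definition heis_form (K : fieldType) k n r (i j : 'I_(k + n)) : K :=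
  ((i < r)%N && ((j : nat) == k + i)%N)%:R
  - ((j < r)%N && ((i : nat) == k + j)%N)%:R.

Section AdaptedBasisExists.
Context (K : fieldType) (L : lieSuperType K) (k n : nat).

Lemma graded_to_adapted (b : graded_basis L k n.+1) r :
  (r <= k)%N ->
  (forall x, [s gb_e1 b ord0, x] = 0) ->
  (forall i j, [s gb_e0 b i, gb_e0 b j] = 0) ->
  (forall i j, [s gb_e1 b i, gb_e1 b j] = 0) ->
  (forall i (j : 'I_n), [s gb_e0 b i, gb_e1 b (lift ord0 j)] =
     (pid_mx r : 'M[K]_(k, n)) i j *: gb_e1 b ord0) ->
  inhabited (adapted_basis L (@odd_index k n) (heis_form K r)).
Proof.
move=> rk zl e00 e11 e01.
have z1 := gb_e1_hcomp b ord0.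
have zr x : [s x, gb_e1 b ord0] = 0.
  move: x; apply: homogeneous_ind => [x y Hx Hy|i x xi]; first by rewrite sbracketAl Hx Hy addr0.
  by rewrite (sbracket_skew xi z1) zl scaler0 oppr0.
have c0lin i a x y : gb_c0 b (a *: x + y) 0 i = a * gb_c0 b x 0 i + gb_c0 b y 0 i.
  by rewrite gb_c0P !mxE.
have c1lin i a x y : gb_c1 b (a *: x + y) 0 i = a * gb_c1 b x 0 i + gb_c1 b y 0 i.
  by rewrite gb_c1P !mxE.
constructor.
exists (fun i => match split i with
                 | inl a => gb_e0 b a
                 | inr a => gb_e1 b (lift ord0 a)
                 end)
  (gb_e1 b ord0)
  (fun i x => match split i with
              | inl a => gb_c0 b x 0 a
              | inr a => gb_c1 b x 0 (lift ord0 a)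
              end)
  (fun x => gb_c1 b x 0 ord0) => //.
- move=> i; rewrite /odd_index; case: splitP => a aE; rewrite aE.
    by rewrite leqNgt ltn_ord; apply: gb_e0_hcomp.
  by rewrite leq_addr; apply: gb_e1_hcomp.
- by move=> i a x y; case: (split i).
- move=> x; rewrite [in LHS](gb_decomp b x) big_split_ord /= -addrA.
  congr (_ + _).
    apply: eq_bigr => i _.
    by rewrite (_ : split (lshift n i) = inl i) //; apply: (unsplitK (inl i)).
  rewrite big_ord_recl addrC; congr (_ + _); apply: eq_bigr => i _.
  by rewrite (_ : split (rshift k i) = inr i) //; apply: (unsplitK (inr i)).
- move=> i x; rewrite /odd_index; case: splitP => a aE; rewrite aE.
    by rewrite leqNgt ltn_ord /= => x1; rewrite gb_c0_odd // mxE.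
  by rewrite leq_addr /= => x0; rewrite gb_c1_even // mxE.
- by move=> x x0; rewrite gb_c1_even // mxE.
- move=> i j; case: splitP => a aE; case: splitP => c cE.
  + rewrite gb_c0e mxE eqxx /=; congr (_%:R); congr nat_of_bool.
    by rewrite -[in RHS]val_eqE /= aE cE.
  + rewrite gb_c0_odd; last exact: gb_e1_hcomp.
    rewrite mxE; case: eqP => // ij; have := ltn_ord a; rewrite -aE ij cE; lia.
  + rewrite gb_c1_even; last exact: gb_e0_hcomp.
    rewrite mxE; case: eqP => // ij; have := ltn_ord c; rewrite -cE -ij aE; lia.
  + rewrite gb_c1e mxE eqxx /=; congr (_%:R); congr nat_of_bool.
    by rewrite -[in RHS]val_eqE /= aE cE eqn_add2l (inj_eq lift_inj).
- move=> i; case: (split i) => a; last by rewrite gb_c1e mxE.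
  by rewrite gb_c1_even ?mxE //; apply: gb_e0_hcomp.
- move=> i; case: (split i) => a; last by rewrite gb_c1e mxE.
  by rewrite gb_c0_odd ?mxE //; apply: gb_e1_hcomp.
- by rewrite gb_c1e mxE.
- move=> i j; rewrite /heis_form; case: splitP => a aE; case: splitP => c cE; rewrite aE cE.
  + rewrite e00 (_ : (_ == _)%N = false) ?andbF; last by have := ltn_ord c; lia.
    rewrite (_ : (_ == _)%N = false) ?andbF; last by have := ltn_ord a; lia.
    by rewrite subrr scale0r.
  + rewrite e01 mxE (_ : (k + c < r)%N = false) ?subr0; last by lia.
    by rewrite eqn_add2l eq_sym andbC.
  + rewrite (sbracket_skew (gb_e1_hcomp b _) (gb_e0_hcomp b _)) e01 mxE.
    rewrite (_ : (k + a < r)%N = false) ?sub0r; last by lia.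
    by rewrite eqn_add2l expr0 scale1r scaleNr eq_sym andbC.
  + rewrite e11 (_ : (k + a < r)%N = false) 1?(_ : (k + c < r)%N = false); try lia.
    by rewrite subrr scale0r.
Qed.
End AdaptedBasisExists.

(** Two eliminations: the row of coordinates of z is completed to an odd basis
that starts with a multiple of z, and the matrix of the pairing with the other
odd vectors is brought to the form pid_mx r.  If r were 0, then L would be
abelian and z zero. *)
Lemma heis_basis_exists (K : fieldType) (L : lieSuperType K) (k l : nat) :
  lie_nilpotent L -> has_sdim (gfull L) k l -> has_sdim (lcs L 2) 0 1 ->
  exists n r, [/\ l = n.+1, (0 < r)%N, (r <= k)%N, (r <= n)%N &
    inhabited (adapted_basis L (@odd_index k n) (heis_form K r))].
Proof.
move=> Lnil Ldim L2dim.
have [z [z1 Lz z0 line even0]] := derived_line L2dim.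
have cent := derived_central Lnil Lz z0 line.
have [b] := graded_basis_exists Ldim.
have zE : z = \sum_i gb_c1 b z 0 i *: gb_e1 b i.
  rewrite [LHS](gb_decomp b) gb_c0_odd // big1 ?add0r // => i _.
  by rewrite mxE scale0r.
case: l b zE {Ldim} => [|n] b zE; first by rewrite zE big_ord0 eqxx in z0.
have subL2 : submodule (lcs L 2 : set L) := gidealS (gidealP _).
set zeta := gb_c1 b z in zE.
have zeta0 : zeta != 0.
  apply: contra z0 => /eqP zeta0; rewrite zE zeta0 big1 // => i _.
  by rewrite mxE scale0r.
(* Gaussian elimination of a nonzero row: it is a multiple of the first row of
   an invertible matrix. *)
have [Q0 [a [Q0u zetaE]]] : exists (Q0 : 'M[K]_n.+1) a,
    Q0 \in unitmx /\ zeta = a *: row ord0 Q0.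
  exists (row_ebase zeta), (col_ebase zeta 0 0); split; first exact: row_ebase_unit.
  rewrite -[LHS]mulmx_ebase.
  rewrite {1}[col_ebase zeta]mx11_scalar rank_rV zeta0 mul_scalar_mx -scalemxAl.
  rewrite rowE; congr (_ *: (_ *m _)); apply/matrixP => i j.
  by rewrite !mxE !ord1 andbT eq_sym; case: j => -[].
have [b1 [_ e1E]] := change_basis b (unitmx1 _ k) Q0u.
set z' := gb_e1 b1 ord0.
have zz' : z = a *: z'.
  rewrite /z' e1E scaler_sumr zE zetaE; apply: eq_bigr => j _.
  by rewrite !mxE scalerA.
have a0 : a != 0 by apply: contra z0 => /eqP a0; rewrite zz' a0 scale0r.
have z'z : z' = a^-1 *: z by rewrite zz' scalerA mulVf // scale1r.
have line' u : (lcs L 2 : set L) u -> exists c, u = c *: z'.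
  by move=> /line [c ->]; exists (c * a); rewrite zz' scalerA.
have brL2 (x y : L) : (lcs L 2 : set L) [s x, y] by apply: mem_scomm.
have /choice [B0 B0P] : forall ij : 'I_k * 'I_n, exists c,
    [s gb_e0 b1 ij.1, gb_e1 b1 (lift ord0 ij.2)] = c *: z'.
  by move=> ij; apply: line'; apply: brL2.
pose B : 'M[K]_(k, n) := \matrix_(i, j) B0 (i, j).
pose D := invmx (row_ebase B).
pose P := invmx (col_ebase B).
(* The block 1 keeps z' in first position. *)
pose Q : 'M[K]_(1 + n) := block_mx 1 0 0 D^T.
have Pu : P \in unitmx by rewrite unitmx_inv col_ebase_unit.
have Qu : Q \in unitmx.
  rewrite unitmxE det_ublock det1 mul1r det_tr -unitmxE unitmx_inv.
  exact: row_ebase_unit.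
have [b2 [e0E e1E']] := change_basis b1 Pu Qu.
have Qsum i : gb_e1 b2 i = Q i (lshift n ord0) *: z'
    + \sum_j Q i (rshift 1 j) *: gb_e1 b1 (lift ord0 j).
  rewrite e1E' (@big_split_ord _ _ _ 1 n) /= big_ord1; congr (_ *: _ + _).
    by rewrite /z'; congr gb_e1; apply: val_inj.
  by apply: eq_bigr => j _; rewrite -rshift1.
have z'E : gb_e1 b2 ord0 = z'.
  rewrite (_ : ord0 = lshift n ord0 :> 'I_(1 + n)); last exact: val_inj.
  rewrite Qsum /Q block_mxEul mxE scale1r big1 ?addr0 // => j _.
  by rewrite block_mxEur mxE scale0r.
have liftE j : gb_e1 b2 (lift ord0 j) = \sum_j' D j' j *: gb_e1 b1 (lift ord0 j').
  rewrite -rshift1 Qsum /Q block_mxEdl mxE scale0r add0r.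
  by apply: eq_bigr => j' _; rewrite block_mxEdr mxE.
have rankP := rank_leq_row B; have rankQ := rank_leq_col B.
have ab : inhabited (adapted_basis L (@odd_index k n) (heis_form K (\rank B))).
  apply: (graded_to_adapted (b := b2)) => //.
  - by move=> x; rewrite z'E z'z sbracketZl cent scaler0.
  - move=> i j; apply: even0; first exact: brL2.
    exact: (sbracket_graded (gb_e0_hcomp _ _) (gb_e0_hcomp _ _)).
  - move=> i j; apply: even0; first exact: brL2.
    exact: (sbracket_graded (gb_e1_hcomp _ _) (gb_e1_hcomp _ _)).
  - move=> i j; rewrite z'E.
    have -> : pid_mx (\rank B) = P *m B *m D :> 'M[K]_(k, n).
      rewrite -{2}[B]mulmx_ebase -mulmxA mulmxK ?row_ebase_unit //.
      by rewrite mulKmx ?col_ebase_unit.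
    rewrite e0E liftE sbracket_suml mxE scaler_suml.
    under eq_bigr => i' _ do rewrite sbracket_sumr scaler_sumr.
    rewrite exchange_big; apply: eq_bigr => j' _.
    rewrite mxE mulr_suml scaler_suml; apply: eq_bigr => i' _.
    by rewrite (B0P (i', j')) !scalerA mxE mulrAC.
exists n, (\rank B); split=> //.
rewrite lt0n; apply/eqP => r0; move: ab; rewrite r0 => -[ab].
apply: (negP z0); apply/eqP.
have sub0 : submodule [set u : L | u = 0].
  by split=> // c u v /= -> ->; rewrite scaler0 addr0.
apply: (smallest_sub sub0 _ Lz) => _ [x _ [y _ <-]] /=.
rewrite (ab_bracket ab) big1 ?scale0r // => i _; rewrite big1 // => j _.
suff -> : heis_form K 0 i j = 0 by rewrite !mulr0.
by rewrite /heis_form !ltn0 subrr.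
Qed.

(** * The multiplier *)

Lemma homogeneous_lift (K : fieldType) (F L : lieSuperType K) (q : F -> L) i v :
  lie_shom q -> (forall y, exists x, q x = y) -> hcomp i v ->
  exists x, hcomp i x /\ q x = v.
Proof.
move=> qhom qsurj vi; have [x qx] := qsurj v.
have key j a b : hcomp j a -> hcomp (~~ j) b -> hcomp j (q a + q b) -> q b = 0.
  move=> aj bj abj; have bj' := shom_hcomp qhom bj.
  have {}abj : hcomp j (q b).
    rewrite -[q b](addKr (q a)) addrC; apply: (submodB (hcomp_submod _)) => //.
    exact: shom_hcomp.
  by case: j {aj bj} abj bj' => h1 h2; apply: hcomp_direct.
have [x0 [x1 [x00 x11 xE]]] := hcomp_decomp x.
rewrite xE (shomD qhom) in qx; case: i vi => vi.
  exists x1; split=> //; rewrite -qx [q x0](key true x1) ?add0r //.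
  by rewrite addrC qx.
by exists x0; split=> //; rewrite -qx [q x1](key false x0) ?addr0 // qx.
Qed.

Section SpanModulo.
Context (K : fieldType) (L : lieSuperType K) (J : set L) (subJ : submodule J).
Context (B : finType) (m : B -> L).

Definition span_mod : set L := fun x => exists c : B -> K, J (x - \sum_b c b *: m b).

Lemma span_mod_submod : submodule span_mod.
Proof.
split=> [|a u v [c Jc] [d Jd]].
  exists (fun _ => 0); rewrite big1 ?subr0 => [|b _]; last exact: scale0r.
  exact: (submod0 subJ).
exists (fun b => a * c b + d b).
have -> : \sum_b (a * c b + d b) *: m b =
    a *: (\sum_b c b *: m b) + \sum_b d b *: m b.
  rewrite scaler_sumr -big_split; apply: eq_bigr => b _.
  by rewrite scalerDl scalerA.
by rewrite opprD addrACA -scalerBr; apply: (submodP subJ).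
Qed.

Lemma span_mod_sub x : J x -> span_mod x.
Proof.
move=> Jx; exists (fun _ => 0).
by rewrite big1 ?subr0 // => b _; apply: scale0r.
Qed.

Lemma span_mod_gen b : span_mod (m b).
Proof.
exists (fun b' => (b' == b)%:R); rewrite (bigD1 b) //= eqxx scale1r big1.
  by rewrite addr0 subrr; apply: (submod0 subJ).
by move=> b' /negPf ->; rewrite scale0r.
Qed.
End SpanModulo.

Section Multiplier.
Context (K : fieldType) (two_neq0 : (2%:R : K) != 0) (L : lieSuperType K).
Context (k n r : nat).
Hypotheses (r_gt0 : (0 < r)%N) (r_le_k : (r <= k)%N) (r_le_n : (r <= n)%N).
Context (b : adapted_basis L (@odd_index k n) (heis_form K r)).
Context (F : lieSuperType K) (X : Type) (par : X -> bool) (inc : X -> F).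
Hypothesis Ffree : free_on par inc.
Context (q : F -> L) (qhom : lie_shom q).

Let prt := @odd_index k n.
Local Notation N := (k + n)%N.
Let R := gker qhom.
Let RF := gcomm R (gfull F).
Let J := gcomm RF (gfull F).
Let I := gcap R (lcs F 3).

Context (g : 'I_N -> F).
Hypothesis g_hcomp : forall i, hcomp (prt i) (g i).
Hypothesis g_lift : forall i, q (g i) = ab_v b i.

Let lt_x : (0 < N)%N. Proof. by lia. Qed.
Let lt_y : (k < N)%N. Proof. by lia. Qed.
Let x : 'I_N := Ordinal lt_x.
Let y : 'I_N := Ordinal lt_y.
Let w := [s g x, g y].

Let px : prt x = false. Proof. by rewrite /prt /odd_index /=; lia. Qed.
Let py : prt y = true. Proof. by rewrite /prt /odd_index /= leqnn. Qed.

Let w_hcomp : hcomp true w.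
Proof. by have := sbracket_graded (g_hcomp x) (g_hcomp y); rewrite px py. Qed.

Let q_gg i j : q [s g i, g j] = heis_form K r i j *: ab_z b.
Proof. by rewrite (shomM qhom) !g_lift ab_vv. Qed.

Let form_xy : heis_form K r x y = 1.
Proof.
by rewrite /heis_form /= r_gt0 addn0 eqxx ltnNge r_le_k /= subr0.
Qed.

Let q_w : q w = ab_z b. Proof. by rewrite q_gg form_xy scale1r. Qed.

Let subJ : submodule (J : set F) := gidealS (gidealP J).

Let w_ker a : (R : set F) [s w, a].
Proof. by rewrite /= (shomM qhom) q_w ab_zl. Qed.

Let gg_ker i j : (R : set F) ([s g i, g j] - heis_form K r i j *: w).
Proof. by rewrite /= (shomB qhom) (shomZ qhom) q_gg q_w subrr. Qed.

Let gg_ker0 i j : heis_form K r i j = 0 -> (R : set F) [s g i, g j].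
Proof. by move=> ij0; rewrite /= q_gg ij0 scale0r. Qed.

Let gw_span a : exists (c : 'I_N -> K) d,
  (R : set F) (a - (\sum_i c i *: g i + d *: w)).
Proof.
exists (fun i => ab_c b i (q a)), (ab_d b (q a)).
rewrite /= (shomB qhom) (shomD qhom) (shomZ qhom) q_w.
rewrite (big_morph q (shomD qhom) (shom0 qhom)).
under eq_bigr => i _ do rewrite (shomZ qhom) g_lift.
by rewrite -ab_decomp subrr.
Qed.

Let cube_ker a : (lcs F 3 : set F) a -> (R : set F) a.
Proof.
apply: (smallest_sub (gidealS (gidealP R))) => _ [u Fu [c _ <-]].
rewrite /= (shomM qhom); move: (q c) => {}c.
have sub1 : submodule [set u | [s q u, c] = 0].
  split=> [|a' u' v' /= u0 v0]; first by rewrite /= (shom0 qhom) sbracket0l.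
  by rewrite (shomP qhom) sbracketDl u0 v0 scaler0 addr0.
apply: (smallest_sub sub1 _ Fu) => _ [a' _ [b' _ <-]] /=.
by rewrite (shomM qhom) (ab_bracket b (q a')) sbracketZl ab_zl scaler0.
Qed.

Let cube_in a c d : (I : set F) [s [s a, c], d].
Proof.
have H : (lcs F 3 : set F) [s [s a, c], d].
  by apply: mem_scomm => //; apply: mem_scomm.
by split=> //; apply: cube_ker.
Qed.

Let comm_in a c : (I : set F) a -> (I : set F) c -> (J : set F) [s a, c].
Proof.
move=> [Ra _] [_ Fc].
have sub1 : submodule [set u | (J : set F) [s a, u]].
  split=> [|a' u' v' /= u0 v0]; first by rewrite /= sbracket0r; apply: (submod0 subJ).
  by rewrite sbracketDr; apply: (submodP subJ).
apply: (smallest_sub sub1 _ Fc) => _ [u _ [v _ <-]].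
exact: (@ker_derived_l _ _ R).
Qed.

Let T (t : hall N) : F := [s [s g (val t).1.1, g (val t).1.2], g (val t).2].
Let Tpar (t : hall N) : bool := hall_odd (val t).

Let T_hcomp t : hcomp (Tpar t) (T t).
Proof. by do 2!apply: sbracket_graded => //. Qed.

Let T_dual (t : hall N) : exists phi : F -> K,
  [/\ forall a u v, phi (a *: u + v) = a * phi u + phi v,
      forall a, (J : set F) a -> phi a = 0,
      phi (T t) != 0, forall u, u != t -> phi (T u) = 0 &
      forall u v a c, phi [s [s [s u, v], a], c] = 0].
Proof.
have [phi [lin phiJ phiT phi4]] :=
  word_form3 Ffree qhom g_hcomp g_lift (hall_word (val t)).
exists phi; split=> // [|u ut]; first by rewrite phiT hall_wcoef.
by apply/eqP; rewrite -[_ == _]negbK phiT hall_wcoef.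
Qed.

Let cube_spanS (S : set F) : submodule S -> (forall a, (J : set F) a -> S a) ->
  (forall t, S (T t)) -> (forall i j, S [s [s w, g i], g j]) ->
  forall a, (I : set F) a -> S a.
Proof.
move=> subS JS TS US a [_ Fa].
apply: (cube_span g_hcomp w_hcomp w_ker gg_ker gw_span subS JS _ US Fa).
exact: (hall_span two_neq0 g_hcomp subS TS).
Qed.

(** For i outside the first dual pair (x, y), w = [x, y] itself shows that
[w, g_i] lies in [R, F]; for i in that pair, the second dual pair does. *)
Lemma multiplier_rank_ge2 : (1 < r)%N -> lie_siso (squo I J)
  (abelian_super K #|[pred t | ~~ Tpar t]| #|[pred t | Tpar t]|).
Proof.
move=> r_gt1; apply: (squo_abelian (m := T)) => //.
- by move=> t; apply: cube_in.
- move=> a Ia.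
  apply: (cube_spanS (span_mod_submod subJ T) (@span_mod_sub _ _ _ _ T)
    (span_mod_gen subJ T)) => // i j.
  apply: span_mod_sub; apply: comm_full_l.
  have [ixy|ixy] := boolP ((i != x) && (i != y)).
    have [ix iy] : (i : nat) <> 0%N /\ (i : nat) <> k.
      by case/andP: ixy => /eqP ix /eqP iy; split=> E; [apply: ix|apply: iy];
        apply: val_inj.
    apply: (w_comm_ker (g_hcomp x) (g_hcomp y)).
    + by rewrite subrr; apply: (submod0 (gidealS (gidealP R))).
    + apply: gg_ker0; rewrite /heis_form /= addn0.
      rewrite (_ : ((i : nat) == k)%N = false) ?andbF; last by lia.
      by rewrite (_ : (0 == _)%N = false) ?andFb ?andbF ?subrr //; lia.
    + apply: gg_ker0; rewrite /heis_form /=.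
      rewrite (_ : (k < r)%N = false); last by lia.
      by rewrite (_ : (k == _)%N = false) ?andFb ?andbF ?subrr //; lia.
  have {}ixy : (i : nat) = 0%N \/ (i : nat) = k.
    by move: ixy; rewrite negb_and !negbK => /orP[] /eqP ->; [left|right].
  have lt_x' : (1 < N)%N by lia.
  have lt_y' : (k.+1 < N)%N by lia.
  apply: (w_comm_ker (g_hcomp (Ordinal lt_x')) (g_hcomp (Ordinal lt_y'))).
  + have := gg_ker (Ordinal lt_x') (Ordinal lt_y').
    rewrite /heis_form /= r_gt1 addn1 eqxx (_ : (k.+1 < r)%N = false) ?subr0 ?scale1r //.
    lia.
  + apply: gg_ker0; rewrite /heis_form /= addn1.
    rewrite (_ : ((i : nat) == _)%N = false) ?andbF; last by lia.
    by rewrite (_ : (i < r)%N && _ = false) ?andFb ?subrr //; lia.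
  + apply: gg_ker0; rewrite /heis_form /=.
    rewrite (_ : (k.+1 < r)%N = false); last by lia.
    by rewrite (_ : (i < r)%N && _ = false) ?andFb ?subrr //; lia.
- move=> c Jc t; have [phi [lin phiJ phit phiT _]] := T_dual t.
  have := phiJ _ Jc; rewrite (lform_sum lin) (bigD1 t) //= big1 => [|u ut].
    by rewrite (lformZ lin) addr0 => /eqP; rewrite mulf_eq0 (negPf phit) orbF => /eqP.
  by rewrite (lformZ lin) phiT // mulr0.
Qed.

Let U (i : bool) : F := [s [s w, g x], g (if i then x else y)].

Let U_hcomp i : hcomp i (U i).
Proof.
have := sbracket_graded (sbracket_graded w_hcomp (g_hcomp x))
  (g_hcomp (if i then x else y)).
by rewrite px; case: i => /=; rewrite ?px ?py.
Qed.

Let U_dual (i : bool) : r = 1%N -> exists phi : F -> K,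
  [/\ forall a u v, phi (a *: u + v) = a * phi u + phi v,
      forall a, (J : set F) a -> phi a = 0, phi (U i) != 0 & phi (U (~~ i)) = 0].
Proof.
move=> r1.
have formE i' j' : heis_form K r i' j' =
    ((i' == x) && (j' == y))%:R - ((i' == y) && (j' == x))%:R.
  rewrite r1 /heis_form /= -!val_eqE /= !ltnS !leqn0.
  congr (_%:R - _%:R); congr nat_of_bool.
    by case: eqP => //= ->; rewrite addn0.
  by rewrite [RHS]andbC; case: eqP => //= ->; rewrite addn0.
have xy : (x == y) = false by apply/eqP => E; move: py; rewrite -E px.
have words (v : nat -> 'I_N) : (forall s, v s = x \/ v s = y) ->
    (forall s, v s = y -> v s.+1 <> y) -> exists phi : F -> K,
    [/\ forall a u v, phi (a *: u + v) = a * phi u + phi v,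
        forall a, (J : set F) a -> phi a = 0 &
        forall m, phi [s [s w, g x], g m] = wcoef4 K prt v x y x m 0].
  move=> vxy vyy.
  pose W := [s word_gen K prt v 4 x, word_gen K prt v 4 y].
  have W1 : hcomp true W.
    have := sbracket_graded (@word_gen_hcomp K N prt v 4 x) (@word_gen_hcomp K N prt v 4 y).
    by rewrite px py.
  have W2 : gl_deg 2 W.
    by apply: (@gl_deg_bracket _ _ _ 1 1); apply: word_gen_deg.
  have [|phi [lin phiJ phi4]] := word_form4 Ffree qhom g_hcomp g_lift W1 W2.
    move=> i' j'; rewrite (word_gen_bracket px py 4 vxy vyy formE) subrr.
    by move=> s t _; rewrite mxE.
  by exists phi; split=> // m; apply: phi4.
case: i.
  have [ s|s sy|phi [lin phiJ phiU]] := words (word_yxxx x y).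
  - by rewrite /word_yxxx; case: eqP; [right|left].
  - by rewrite /word_yxxx /=; apply/eqP; rewrite xy.
  exists phi; split=> //; rewrite phiU (wcoef_yxxx _ px py) ?eqxx ?orbT //.
    by rewrite oppr_eq0 oner_eq0.
  by rewrite eq_sym xy oppr0.
have [ s|s sy|phi [lin phiJ phiU]] := words (word_xyxy x y).
- by rewrite /word_xyxy; case: odd; [right|left].
- move: sy; rewrite /word_xyxy /=; case: odd => //= E; first by apply/eqP; rewrite xy.
  by move/eqP: E; rewrite xy.
exists phi; split=> //; rewrite phiU (wcoef_xyxy _ px py) ?eqxx ?orbT //.
  by rewrite mulr1.
by rewrite xy mulr0.
Qed.

(** The only quartic brackets that survive are [[w, x], x] and [[w, x], y].  The
forms that detect Hall brackets vanish on them, so independence follows in two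
steps: the Hall coefficients are zero, then the other two. *)
Lemma multiplier_rank1 : r = 1%N -> lie_siso (squo I J)
  (abelian_super K #|[pred t | ~~ Tpar t]|.+1 #|[pred t | Tpar t]|.+1).
Proof.
move=> r1.
pose m (t : hall N + bool) := match t with inl t => T t | inr i => U i end.
pose mpar (t : hall N + bool) := match t with inl t => Tpar t | inr i => i end.
have cardm (a : bool) : #|[pred t | mpar t == a]| = #|[pred t | Tpar t == a]|.+1.
  rewrite -!sum1_card big_sumType /= -[RHS]addn1; congr (_ + _)%N.
  by rewrite (big_pred1 a).
have c1 : #|[pred t | Tpar t]|.+1 = #|[pred t | mpar t]|.
  transitivity #|[pred t | Tpar t == true]|.+1.
    by congr S; apply: eq_card => t; rewrite !inE eqb_id.
  by rewrite -cardm; apply: eq_card => t; rewrite !inE eqb_id.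
have c0 : #|[pred t | ~~ Tpar t]|.+1 = #|[pred t | ~~ mpar t]|.
  transitivity #|[pred t | Tpar t == false]|.+1.
    by congr S; apply: eq_card => t; rewrite !inE eqbF_neg.
  by rewrite -cardm; apply: eq_card => t; rewrite !inE eqbF_neg.
rewrite c0 c1; apply: (squo_abelian (m := m)) => //.
- by case=> t; apply: cube_in.
- by case=> t; [apply: T_hcomp|apply: U_hcomp].
- move=> a Ia.
  have subS := span_mod_submod subJ m.
  apply: (cube_spanS subS (@span_mod_sub _ _ _ _ m)
    (fun t => span_mod_gen subJ m (inl t))) => // i j.
  have out i' : i' != x -> i' != y -> (i' : nat) <> 0%N /\ (i' : nat) <> k.
    move=> /eqP ix /eqP iy; split=> E; [apply: ix|apply: iy]; exact: val_inj.
  have xR i' : i' != y -> (R : set F) [s g x, g i'].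
    move=> /eqP iy; have {}iy : (i' : nat) <> k by move=> E; apply: iy; apply: val_inj.
    apply: gg_ker0; rewrite /heis_form /= addn0.
    rewrite (_ : ((i' : nat) == k)%N = false) ?andbF; last by lia.
    by rewrite (_ : (0 == _)%N = false) ?andFb ?andbF ?subrr //; lia.
  have yR i' : i' != x -> (R : set F) [s g y, g i'].
    move=> /eqP ix; have {}ix : (i' : nat) <> 0%N by move=> E; apply: ix; apply: val_inj.
    apply: gg_ker0; rewrite /heis_form /=.
    rewrite (_ : (k < r)%N = false); last by lia.
    by rewrite (_ : (k == _)%N = false) ?andFb ?andbF ?subrr //; lia.
  have yx : y != x by apply/eqP => E; move: py; rewrite E px.
  have wi i' : i' != x -> (RF : set F) [s w, g i'].
    move=> ix; have [->|iy] := eqVneq i' y.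
      exact: (w_comm_odd g_hcomp w_hcomp two_neq0 px py (yR _ yx)).
    apply: (w_comm_ker (g_hcomp x) (g_hcomp y)) (xR _ iy) (yR _ ix).
    by rewrite subrr; apply: (submod0 (gidealS (gidealP R))).
  have [->|ix] := eqVneq i x; last first.
    by apply: span_mod_sub; apply: comm_full_l; apply: wi.
  have [->|jx] := eqVneq j x; first exact: (span_mod_gen subJ m (inr true)).
  have [->|jy] := eqVneq j y; first exact: (span_mod_gen subJ m (inr false)).
  apply: span_mod_sub.
  by apply: (w_comm_span g_hcomp w_hcomp); [apply: xR|apply: wi].
- move=> c; rewrite big_sumType /= => Jc.
  have cT t : c (inl t) = 0.
    have [phi [lin phiJ phit phiT phi4]] := T_dual t.
    have := phiJ _ Jc; rewrite (lformD lin) !(lform_sum lin) (bigD1 t) //= big1 => [|u ut].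
      rewrite big1 => [|i _]; last by rewrite (lformZ lin) phi4 mulr0.
      by rewrite (lformZ lin) !addr0 => /eqP; rewrite mulf_eq0 (negPf phit) orbF => /eqP.
    by rewrite (lformZ lin) phiT // mulr0.
  case=> [//|i]; have [phi [lin phiJ phii phii']] := U_dual i r1.
  have := phiJ _ Jc; rewrite big1 ?add0r => [|t _]; last by rewrite cT scale0r.
  rewrite (lform_sum lin) (bigD1 i) //= (big_pred1 (~~ i)) => [|j]; last first.
    by case: i j {phii phii'} => [] [].
  rewrite !(lformZ lin) phii' mulr0 addr0 => /eqP.
  by rewrite mulf_eq0 (negPf phii) orbF => /eqP.
Qed.
End Multiplier.

(** * Counting Hall triples *)

Section HallCount.
Local Open Scope nat_scope.

Lemma card_hall_sum N (P : pred ('I_N * 'I_N * 'I_N)) :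
  #|[pred t : hall N | P (val t)]| =
  \sum_(j < N) \sum_(i < N) \sum_(h < N) [&& j < i, j <= h & P (i, j, h)].
Proof.
have -> : #|[pred t : hall N | P (val t)]| = #|[pred t | is_hall t && P t]|.
  rewrite -(card_image val_inj); apply: eq_card => t; rewrite [RHS]inE /=.
  apply/fintype.imageP/andP => [[u Pu ->]|[ht Pt]]; first by split; [exact: (valP u)|].
  by exists (exist (fun t => is_hall t) t ht).
rewrite -sum1_card big_mkcond /= exchange_big pair_big pair_big /=.
by apply: eq_bigr => [[[i j] h] _]; rewrite inE /is_hall /= andbA; case: andP.
Qed.

Definition cube_hall n :=
  \sum_(j < n) \sum_(i < n) \sum_(h < n) ((j < i) && (j <= h) : nat).

(** The triples with smallest entry 0 contribute n (n + 1), and the others form a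
copy of the triples on n letters. *)
Lemma cube_hallE n : 3 * cube_hall n + n = n ^ 3.
Proof.
elim: n => [|n IHn]; first by rewrite /cube_hall big_ord0.
suff -> : cube_hall n.+1 = n * n.+1 + cube_hall n by nia.
rewrite /cube_hall big_ord_recl; congr (_ + _).
  rewrite big_ord_recl big1 // add0n.
  under eq_bigr => i _ do (under eq_bigr => h _ do rewrite /=; rewrite sum1_card card_ord).
  by rewrite sum_nat_const card_ord.
apply: eq_bigr => j _; rewrite big_ord_recl big1 // add0n.
apply: eq_bigr => i _; rewrite big_ord_recl andbF add0n.
by apply: eq_bigr => h _.
Qed.

Lemma sum_leq_gt k :
  \sum_(j < k) \sum_(h < k) (j <= h : nat)
    + \sum_(j < k) \sum_(i < k) (j < i : nat) = k * k.
Proof.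
rewrite [X in _ + X]exchange_big -big_split /= -[in RHS](card_ord k) -sum_nat_const.
rewrite [RHS](eq_bigr (fun _ => k)); last by rewrite card_ord.
apply: eq_bigr => j _; rewrite -big_split /= -[RHS](card_ord k) -sum1_card.
by apply: eq_bigr => h _; case: leqP.
Qed.

Context (k n : nat).

Let oddL (i : 'I_k) : odd_index (lshift n i) = false.
Proof. by rewrite /odd_index /= leqNgt ltn_ord. Qed.

Let oddR (i : 'I_n) : odd_index (rshift k i) = true.
Proof. by rewrite /odd_index /= leq_addr. Qed.

Let LR (i : 'I_k) (j : 'I_n) : i < k + j.
Proof. by apply: leq_trans (ltn_ord i) (leq_addr _ _). Qed.

Let RL (i : 'I_k) (j : 'I_n) : (k + j < i) = false.
Proof. by apply/negP; have := ltn_ord i; lia. Qed.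

Let RL' (i : 'I_k) (j : 'I_n) : (k + j <= i) = false.
Proof. by apply/negP; have := ltn_ord i; lia. Qed.

Let split3 (G : 'I_(k + n) -> 'I_(k + n) -> 'I_(k + n) -> nat) :
  \sum_j \sum_i \sum_h G j i h =
  (\sum_j \sum_i \sum_h G (lshift n j) (lshift n i) (lshift n h)
   + \sum_j \sum_i \sum_h G (lshift n j) (lshift n i) (rshift k h)
   + (\sum_j \sum_i \sum_h G (lshift n j) (rshift k i) (lshift n h)
   + \sum_j \sum_i \sum_h G (lshift n j) (rshift k i) (rshift k h)))
  + (\sum_j \sum_i \sum_h G (rshift k j) (lshift n i) (lshift n h)
   + \sum_j \sum_i \sum_h G (rshift k j) (lshift n i) (rshift k h)
   + (\sum_j \sum_i \sum_h G (rshift k j) (rshift k i) (lshift n h)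
   + \sum_j \sum_i \sum_h G (rshift k j) (rshift k i) (rshift k h))).
Proof.
rewrite big_split_ord; congr (_ + _); rewrite -!big_split; apply: eq_bigr => j _;
  rewrite big_split_ord; congr (_ + _); rewrite -!big_split; apply: eq_bigr => i _;
  by rewrite big_split_ord.
Qed.

Let zero3 (a b c : nat) (G : 'I_a -> 'I_b -> 'I_c -> nat) :
  (forall j i h, G j i h = 0) -> \sum_j \sum_i \sum_h G j i h = 0.
Proof. by move=> G0; do 3!rewrite big1 // => ? _. Qed.

(** The middle letter is minimal and even letters come first, so a triple of
even parity has three even letters, or an even middle letter between two
arbitrary odd ones. *)
Lemma card_hall_even : #|[pred t : hall (k + n) | ~~ hall_odd (val t)]| =
  cube_hall k + k * n ^ 2.
Proof.
rewrite (card_hall_sum (fun t => ~~ hall_odd t)) split3 /hall_odd /=.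
transitivity ((cube_hall k + 0 + (0 + k * n ^ 2)) + (0 + 0 + (0 + 0))); last by lia.
congr (_ + _ + (_ + _) + (_ + _ + (_ + _))).
- by do 3!(apply: eq_bigr => ? _); rewrite !oddL andbT.
- by apply: zero3 => j i h; rewrite !oddL oddR !andbF.
- by apply: zero3 => j i h; rewrite !oddL oddR !andbF.
- transitivity (\sum_(j < k) \sum_(i < n) \sum_(h < n) 1).
    do 3!(apply: eq_bigr => ? _).
    by rewrite LR ltnW ?LR // oddL !oddR.
  by rewrite !sum_nat_const !card_ord muln1.
- by apply: zero3 => j i h; rewrite RL.
- by apply: zero3 => j i h; rewrite RL.
- by apply: zero3 => j i h; rewrite RL' andbF.
- by apply: zero3 => j i h; rewrite !oddR !andbF.
Qed.

(** Apart from the triples of odd letters, the middle letter is even and exactly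
one of the outer letters is odd; the two cases add up by sum_leq_gt. *)
Lemma card_hall_odd : #|[pred t : hall (k + n) | hall_odd (val t)]| =
  cube_hall n + n * k ^ 2.
Proof.
rewrite (card_hall_sum (@hall_odd k n)) split3 /hall_odd /=.
pose A := \sum_(j < k) \sum_(i < k) (j < i : nat).
pose C := \sum_(j < k) \sum_(h < k) (j <= h : nat).
have AC : C + A = k * k := sum_leq_gt k.
transitivity ((0 + A * n + (C * n + 0)) + (0 + 0 + (0 + cube_hall n))); last by nia.
congr (_ + _ + (_ + _) + (_ + _ + (_ + _))).
- by apply: zero3 => j i h; rewrite !oddL !andbF.
- rewrite big_distrl; apply: eq_bigr => j _; rewrite big_distrl.
  apply: eq_bigr => i _ /=; rewrite mulnC -[X in X * _](card_ord n) -sum_nat_const.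
  by apply: eq_bigr => h _; rewrite !oddL oddR (ltnW (LR j h)) /= ?andbT.
- rewrite big_distrl; apply: eq_bigr => j _; rewrite exchange_big big_distrl.
  apply: eq_bigr => h _ /=; rewrite mulnC -[X in X * _](card_ord n) -sum_nat_const.
  by apply: eq_bigr => i _; rewrite !oddL oddR LR /= ?andbT.
- by apply: zero3 => j i h; rewrite oddL !oddR !andbF.
- by apply: zero3 => j i h; rewrite RL.
- by apply: zero3 => j i h; rewrite RL.
- by apply: zero3 => j i h; rewrite RL' andbF.
- by do 3!(apply: eq_bigr => ? _); rewrite !oddR ltn_add2l leq_add2l /= andbT.
Qed.
End HallCount.

Theorem theorem5p16 (K : closedFieldType) (two_neq0 : (2%:R : K) != 0)
    (L : lieSuperType K) (k l : nat) :
  lie_nilpotent L -> has_sdim (gfull L) k l -> has_sdim (lcs L 2) 0 1 ->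
  forall P : free_presentation L,
  let k' : rat := k%:R in let l' : rat := l%:R in
  (exists a b : nat,
     [/\ a%:R = 3%:R^-1 * k' * (k' + 1) * (k' - 1) + k' * (l' - 1) ^+ 2 + 1,
         b%:R = 3%:R^-1 * l' * (l' - 1) * (l' + 1)
                + (l' - 1) * (k' ^+ 2 - l') + 1 &
         lie_siso (nil2_multiplier P) (abelian_super K a b)]) \/
  (exists a b : nat,
     [/\ a%:R = 3%:R^-1 * k' * (k' + 1) * (k' - 1) + k' * (l' - 1) ^+ 2,
         b%:R = 3%:R^-1 * l' * (l' - 1) * (l' + 1)
                + (l' - 1) * (k' ^+ 2 - l') &
         lie_siso (nil2_multiplier P) (abelian_super K a b)]).
Proof.
move=> Lnil Ldim L2dim P k' l'.
have [n [r [lE r0 rk rn [ab]]]] := heis_basis_exists Lnil Ldim L2dim.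
have /choice [g gP] : forall i : 'I_(k + n), exists x : fp_alg P,
    hcomp (odd_index i) x /\ fp_map x = ab_v ab i.
  by move=> i; apply: (homogeneous_lift (fp_hom P) (@fp_surj _ _ P) (ab_v_hcomp ab i)).
have gh i : hcomp (odd_index i) (g i) by case: (gP i).
have gq i : fp_map (g i) = ab_v ab i by case: (gP i).
have cubeE m : (3 * cube_hall m)%N%:R = m%:R * (m%:R + 1) * (m%:R - 1) :> rat.
  apply: (addIr m%:R); rewrite -natrD cube_hallE natrX; ring.
have evenE : (cube_hall k + k * n ^ 2)%N%:R =
    3%:R^-1 * k' * (k' + 1) * (k' - 1) + k' * (l' - 1) ^+ 2 :> rat.
  have -> : l' - 1 = n%:R by rewrite /l' lE -natr1 addrK.
  rewrite natrD natrM natrX; congr (_ + _).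
  by rewrite -!mulrA [X in _ = _ * X]mulrA -cubeE natrM mulKf.
have oddE : (cube_hall n + n * k ^ 2)%N%:R =
    3%:R^-1 * l' * (l' - 1) * (l' + 1) + (l' - 1) * (k' ^+ 2 - l') :> rat.
  have -> : l' = n%:R + 1 by rewrite /l' lE natr1.
  have := cubeE n; rewrite natrM => E.
  rewrite natrD natrM natrX.
  have -> : (cube_hall n)%:R = 3%:R^-1 * (n%:R * (n%:R + 1) * (n%:R - 1)) :> rat.
    by rewrite -E mulKf.
  by rewrite -/k'; field.
have ranks : r = 1%N \/ (1 < r)%N by lia.
case: ranks => [r1|r2]; [left|right].
  exists (cube_hall k + k * n ^ 2).+1, (cube_hall n + n * k ^ 2).+1.
  split; [by rewrite -natr1 evenE|by rewrite -natr1 oddE|].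
  rewrite -card_hall_even -card_hall_odd.
  exact: (multiplier_rank1 two_neq0 r0 rk rn (fp_free P) (fp_hom P) gh gq r1).
exists (cube_hall k + k * n ^ 2)%N, (cube_hall n + n * k ^ 2)%N.
split=> //; rewrite -card_hall_even -card_hall_odd.
exact: (multiplier_rank_ge2 two_neq0 r0 rk rn (fp_free P) (fp_hom P) gh gq r2).
Qed.
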